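(* Let $X$, $\mathcal H_\alpha$, $\{k_x^\alpha\}_{x\in X}$, $\nu_\alpha$ be as described in the context. Assume that $d\nu_\alpha=c(\alpha)\,d\nu$ with $c(\alpha)>0$ and $\nu$ a Radon measure on $X$ independent of $\alpha$, and that for every $x\in X$ and every neighborhood $U$ of $x$, $\int_{X\setminus U}|\langle k_x^\alpha,k_y^\alpha\rangle_\alpha|^2\,d\nu_\alpha(y)\to0$ as $\alpha\to\infty$. Let $\sigma\in L^1(X,\nu)$ be real-valued and, in addition, bounded or non-negative. Let $\{\lambda_j^{(\alpha)}\}$ denote the eigenvalues of $T_\sigma^\alpha$ in decreasing order (counted with multiplicity). If $t>0$ satisfies $\nu(\{\sigma=t\})=0$, then $$\lim_{\alpha\to\infty}\frac1{c(\alpha)}\#\{j:\lambda_j^{(\alpha)}>t\}=\nu(\{\sigma>t\}).$$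
   Context: $X$ is a locally compact Hausdorff space. For each value of a parameter $\alpha$ (limits are taken as $\alpha\to\infty$), $\mathcal H_\alpha$ is a Hilbert space with inner product $\langle\cdot,\cdot\rangle_\alpha$, and $\{k_x^\alpha:x\in X\}\subset\mathcal H_\alpha$ is a normalized continuous Parseval frame with frame Radon measure $\nu_\alpha$ on $X$: $\|k_x^\alpha\|_\alpha=1$ for all $x$, the functions $x\mapsto\langle f,k_x^\alpha\rangle_\alpha$ are Borel measurable, and $f=\int_X\langle f,k_x^\alpha\rangle_\alpha k_x^\alpha\,d\nu_\alpha(x)$ weakly for every $f\in\mathcal H_\alpha$. For $\sigma\in L^1(X,\nu)$ the Toeplitz operator is $T_\sigma^\alpha f=\int_X\sigma(x)\langle f,k_x^\alpha\rangle_\alpha k_x^\alpha\,d\nu_\alpha(x)$ (weakly defined); it is trace class, and self-adjoint for real-valued $\sigma$. *)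

(* Defs.v *)
From HB Require Import structures.
From mathcomp Require Import all_boot all_order all_algebra.
From mathcomp Require Import complex.
From mathcomp Require Import all_classical all_reals all_analysis.

Set Implicit Arguments.
Unset Strict Implicit.
Unset Printing Implicit Defensive.

Import Order.TTheory GRing.Theory Num.Theory Num.Def.
Import numFieldNormedType.Exports.

Local Open Scope classical_set_scope.
Local Open Scope ring_scope.
Local Open Scope complex_scope.

(* X with its Borel sigma-algebra.  Measurable types of the library are
   pointed, so X is taken nonempty. *)
Notation borel X := (g_sigma_algebraType (@open X)).

Section Radon.
Context (R : realType) (X : ptopologicalType).

Definition radon (nu : {measure set (borel X) -> \bar R}) : Prop :=
  [/\ forall K : set X, compact K -> (nu K < +oo)%E,
      forall B : set (borel X), measurable B ->
        nu B = ereal_inf [set nu U | U in [set U : set X | open U /\ B `<=` U]]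
    & forall U : set X, open U ->
        nu U = ereal_sup [set nu K | K in [set K : set X | compact K /\ K `<=` U]]].

End Radon.

Section ComplexIntegral.
Context d (T : measurableType d) (R : realType).

Definition cmeasurable (f : T -> R[i]) : Prop :=
  measurable_fun [set: T] (fun x => complex.Re (f x)) /\
  measurable_fun [set: T] (fun x => complex.Im (f x)).

Definition cintegrable (mu : {measure set T -> \bar R}) (f : T -> R[i]) : Prop :=
  mu.-integrable [set: T] (fun x => (complex.Re (f x))%:E) /\
  mu.-integrable [set: T] (fun x => (complex.Im (f x))%:E).

Definition cintegral (mu : {measure set T -> \bar R}) (f : T -> R[i]) : R[i] :=
  (\int[mu]_x complex.Re (f x)) +i* (\int[mu]_x complex.Im (f x)).

End ComplexIntegral.

Section Hilbert.
Context (R : realType) (H : completeNormedModType R[i]).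

(* A {dot _ for conjC} form is linear in its first argument. *)
Definition norm_from_dot (ip : {dot H for (@conjC R[i])}) : Prop :=
  forall u : H, `|u| ^+ 2 = ip u u.

Definition lin_indep n (e : 'I_n -> H) : Prop :=
  forall a : 'I_n -> R[i], \sum_(i < n) a i *: e i = 0 -> forall i, a i = 0.

(* Dimension of ker (T - l), possibly +oo; it is 0 when l is not an
   eigenvalue. *)
Definition multiplicity (T : H -> H) (l : R[i]) : \bar R :=
  ereal_sup [set n%:R%:E | n in [set n : nat |
    exists e : 'I_n -> H, lin_indep e /\ forall i, T (e i) = l *: e i]].

(* #{j : lambda_j > t} for an enumeration (lambda_j) of the real eigenvalues
   of T counted with multiplicity; it does not depend on the enumeration. *)
Definition eigenvalue_count (T : H -> H) (t : R) : \bar R :=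
  (\esum_(l in [set l : R | (t < l)%R]) multiplicity T l%:C)%E.

Context d (X : measurableType d) (ip : {dot H for (@conjC R[i])})
  (mu : {measure set X -> \bar R}).

Definition is_weak_integral (F : X -> H) (u : H) : Prop :=
  forall g : H, cintegrable mu (fun x => ip (F x) g) /\
    ip u g = cintegral mu (fun x => ip (F x) g).

(* 0 when F is not weakly integrable. *)
Definition weak_integral (F : X -> H) : H := xget 0 (is_weak_integral F).

Definition toeplitz (k : X -> H) (sigma : X -> R) (f : H) : H :=
  weak_integral (fun x => ((sigma x)%:C * ip f (k x)) *: k x).

Definition normalized_parseval_frame (k : X -> H) : Prop :=
  [/\ forall x, `|k x| = 1,
      forall f, cmeasurable (fun x => ip f (k x))
    & forall f, is_weak_integral (fun x => ip f (k x) *: k x) f].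

End Hilbert.

(* Main.v *)
Require Import Defs.
From HB Require Import structures.
From mathcomp Require Import all_boot all_order all_algebra.
From mathcomp Require Import complex.
From mathcomp Require Import all_classical all_reals all_analysis.
From mathcomp Require Import measurable_realfun.
From mathcomp Require Import ring lra.

Set Implicit Arguments.
Unset Strict Implicit.
Unset Printing Implicit Defensive.

Import Order.TTheory GRing.Theory Num.Theory Num.Def.
Import numFieldNormedType.Exports HBSimple.

Local Open Scope classical_set_scope.
Local Open Scope ring_scope.
Local Open Scope complex_scope.

(* For a Toeplitz operator T with symbol s and ordered eigenvalues l_j, write
   F(t) = c^-1 sum_j (l_j - t)_+.  Jensen's inequality for the Parseval frame
   gives F(t) <= int (s - t)_+ dnu.  Conversely the vectors k_x yield
   sum_j (l_j - t)_+ |<k_x, e_j>|^2 >= <T k_x, k_x> - t.  If s is bounded and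
   lower semicontinuous, localization makes the lower limit of the right-hand
   side at least s(x) - t, so that liminf F(t) >= int (s - t)_+ dnu by Fatou;
   the general case follows because such symbols are dense in L^1 and F is
   Lipschitz in s for the L^1 norm, by the variational characterization of
   sum_j (l_j - t)_+ over orthonormal families.  For
   a < t < b, c^-1 #{l_j > t} lies between (F(t) - F(b)) / (b - t) and
   (F(a) - F(t)) / (t - a); in the limit these are at least nu{s > b} and at
   most nu{s > a}, which are close to nu{s > t} since nu{s = t} = 0.

   Eigenvalues are produced from the quadratic form of T alone: it is compact
   because the form of |s| has bounded trace over orthonormal families. *)

(** * Hermitian forms on a Hilbert space *)

Section ComplexModulus.
Context (R : realType).
Implicit Types z w : R[i].

Definition sqabs z : R := complex.Re z ^+ 2 + complex.Im z ^+ 2.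

Lemma sqabsE z : Normc.normc z ^+ 2 = sqabs z.
Proof. by case: z => x y; rewrite /= sqr_sqrtr // addr_ge0 ?sqr_ge0. Qed.

Lemma sqabs_ge0 z : 0 <= sqabs z.
Proof. by rewrite addr_ge0 ?sqr_ge0. Qed.

Lemma Re_conj z : complex.Re (conjC z) = complex.Re z.
Proof. by case: z. Qed.

Lemma sqabs_conj z : sqabs (conjC z) = sqabs z.
Proof. by case: z => x y; rewrite /sqabs /= sqrrN. Qed.

Lemma Re_mul_conj z : complex.Re (z * conjC z) = sqabs z.
Proof. by case: z => x y; rewrite /sqabs /= mulrN opprK !expr2. Qed.

Lemma Re_realM (r : R) z : complex.Re (r%:C * z) = r * complex.Re z.
Proof. by case: z => x y; rewrite /= mul0r subr0. Qed.

Lemma Im_realM (r : R) z : complex.Im (r%:C * z) = r * complex.Im z.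
Proof. by case: z => x y; rewrite /= mul0r addr0. Qed.

End ComplexModulus.

Section RealForms.
Context (R : realType) (H : completeNormedModType R[i]).
Implicit Types (b : H -> H -> R) (f g h : H).

(* Real parts of Hermitian forms: real bilinear symmetric forms for which
   multiplication by z and by its conjugate are adjoint. *)
Definition hform b : Prop :=
  [/\ forall f g h, b (f + g) h = b f h + b g h,
      forall f g, b f g = b g f,
      forall (r : R) f g, b (r%:C *: f) g = r * b f g
    & forall (z : R[i]) f g, b (z *: f) g = b f (conjC z *: g)].

Section Theory.
Context (b : H -> H -> R) (hb : hform b).

Lemma hformDl f g h : b (f + g) h = b f h + b g h.
Proof. by case: hb. Qed.
Lemma hformC f g : b f g = b g f.
Proof. by case: hb. Qed.
Lemma hformZl r f g : b (r%:C *: f) g = r * b f g.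
Proof. by case: hb. Qed.
Lemma hform_conj z f g : b (z *: f) g = b f (conjC z *: g).
Proof. by case: hb. Qed.
Lemma hformDr f g h : b f (g + h) = b f g + b f h.
Proof. by rewrite hformC hformDl !(hformC f). Qed.
Lemma hformZr r f g : b f (r%:C *: g) = r * b f g.
Proof. by rewrite hformC hformZl hformC. Qed.
Lemma hform0l g : b 0 g = 0.
Proof. by rewrite -(scale0r (0 : H)) hformZl mul0r. Qed.
Lemma hformNl f g : b (- f) g = - b f g.
Proof. by apply/eqP; rewrite -addr_eq0 -hformDl addNr hform0l. Qed.
Lemma hformNr f g : b f (- g) = - b f g.
Proof. by rewrite hformC hformNl hformC. Qed.
Lemma hformBl f g h : b (f - g) h = b f h - b g h.
Proof. by rewrite hformDl hformNl. Qed.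
Lemma hformBr f g h : b f (g - h) = b f g - b f h.
Proof. by rewrite hformDr hformNr. Qed.
Lemma hform_suml (I : finType) (F : I -> H) g :
  b (\sum_i F i) g = \sum_i b (F i) g.
Proof.
by apply: (big_morph (b^~ g)) => [x y|]; rewrite ?hformDl ?hform0l.
Qed.

Lemma hform_sqrD f g : b (f + g) (f + g) = b f f + 2 * b f g + b g g.
Proof. rewrite !hformDl !hformDr (hformC g f); ring. Qed.

Lemma hform_parallelogram f g :
  b (f + g) (f + g) + b (f - g) (f - g) = 2 * b f f + 2 * b g g.
Proof. rewrite !(hformDl, hformDr, hformNl, hformNr); ring. Qed.

Lemma hform_le_parallelogram f g : 0 <= b (f - g) (f - g) ->
  b (f + g) (f + g) <= 2 * b f f + 2 * b g g.
Proof. by have := hform_parallelogram f g; lra. Qed.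

(** A degenerate Cauchy-Schwarz inequality: as [b f f = 0], the form at [g + r f] is affine in [r],
    and an affine function bounded below has slope zero. *)
Lemma hform_eq0 f g : b f f = 0 ->
  (forall r : R, 0 <= b (g + r%:C *: f) (g + r%:C *: f)) -> b f g = 0.
Proof.
move=> bff pos.
have {}pos r : 0 <= b g g + 2 * r * b f g.
  have := pos r; rewrite hform_sqrD hformZr hformZl hformZr bff (hformC g f).
  by lra.
(* At this [r] the affine function takes the value -1. *)
apply/eqP/contraT => nz; have := pos (- (b g g + 1) / (2 * b f g)).
rewrite (_ : 2 * _ * _ = - (b g g + 1)); first by lra.
by field.
Qed.

End Theory.

Lemma hformB b b' : hform b -> hform b' -> hform (fun f g => b f g - b' f g).
Proof.
move=> hb hb'; split=> *.
- by rewrite !hformDl // addrACA -opprD.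
- by rewrite (hformC hb) (hformC hb').
- by rewrite !hformZl // mulrBr.
- by rewrite (hform_conj hb) (hform_conj hb').
Qed.

Lemma hformMl (r : R) b : hform b -> hform (fun f g => r * b f g).
Proof.
move=> hb; split=> *.
- by rewrite !hformDl // mulrDr.
- by rewrite (hformC hb).
- by rewrite !hformZl // mulrCA.
- by rewrite (hform_conj hb).
Qed.

End RealForms.

Section HilbertSpace.
Context (R : realType) (H : completeNormedModType R[i])
  (ip : {dot H for (@conjC R[i])}) (hilb : norm_from_dot ip).
Implicit Types (f g h : H).

Definition rip f g : R := complex.Re (ip f g).

Lemma ipC f g : ip f g = conjC (ip g f).
Proof. by rewrite hermC expr0 mul1r. Qed.

Lemma rip_hform : hform rip.
Proof.
split=> *; rewrite /rip.
- by rewrite linearDl raddfD.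
- by rewrite ipC Re_conj.
- by rewrite linearZl_LR Re_realM.
- by rewrite linearZl_LR linearZr_LR /= conjCK.
Qed.

Lemma ip_rip f : ip f f = (rip f f)%:C.
Proof.
rewrite /rip RRe_real // ger0_real //; exact: dnorm_ge0.
Qed.

Lemma rip_ge0 f : 0 <= rip f f.
Proof. by rewrite -ler0c -ip_rip; exact: dnorm_ge0. Qed.

Lemma rip_eq0 f : rip f f = 0 -> f = 0.
Proof. by move=> f0; apply/eqP; rewrite -(dnorm_eq0 ip) ip_rip f0. Qed.

Lemma norm_rip f : `|f| = (Num.sqrt (rip f f))%:C.
Proof.
apply/eqP; rewrite -(@eqrXn2 _ 2) //.
  by rewrite hilb ip_rip -rmorphXn /= sqr_sqrtr // rip_ge0.
by rewrite ler0c sqrtr_ge0.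
Qed.

(** As [ip] is conjugate linear in its second argument, its real part determines it, so the theory
    can be run on real forms. *)
Lemma rip_i f g : complex.Im (ip f g) = rip f ('i *: g).
Proof. by rewrite /rip linearZr_LR /=; case: (ip f g) => x y /=; ring. Qed.

Lemma rip_inj f g : (forall h, rip f h = rip g h) -> f = g.
Proof.
move=> fg; apply/subr0_eq/rip_eq0.
by rewrite (hformBl rip_hform) fg subrr.
Qed.

Definition orthonormal_family (I : finType) (e : I -> H) : Prop :=
  forall i j, ip (e i) (e j) = (i == j)%:R.

(** A weak eigenvalue equation, meaningful for a form without an operator; [f] may be 0. *)
Definition eigenvec (b : H -> H -> R) (f : H) (l : R) : Prop :=
  forall g, b f g = l * rip f g.

Lemma eigenvec_rip f : eigenvec rip f 1.
Proof. by move=> g; rewrite mul1r. Qed.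

Definition proj (I : finType) (e : I -> H) f : H := \sum_i ip f (e i) *: e i.

Section Orthonormal.
Context (I : finType) (e : I -> H) (one : orthonormal_family e).

Lemma ip_comb (a : I -> R[i]) j : ip (\sum_i a i *: e i) (e j) = a j.
Proof.
rewrite linear_sumlz (bigD1 j) //= linearZl_LR /= one eqxx mulr1.
rewrite big1 ?addr0 // => i ij.
by rewrite linearZl_LR /= one (negbTE ij) mulr0.
Qed.

Lemma ip_proj f j : ip (proj e f) (e j) = ip f (e j).
Proof. exact: ip_comb. Qed.

Lemma ip_residual f j : ip (f - proj e f) (e j) = 0.
Proof. by rewrite linearBl /= ip_proj subrr. Qed.

(** Being eigenvectors, the [e i] are orthogonal to the residual for [b] as well as for [ip], so the
    cross term vanishes. With [b = rip] and all [l i = 1] this is the usual Pythagorean identity. *)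
Lemma hform_eigen_pythagoras b (l : I -> R) f : hform b ->
  (forall i, eigenvec b (e i) (l i)) ->
  b f f = \sum_i l i * sqabs (ip f (e i)) + b (f - proj e f) (f - proj e f).
Proof.
move=> hb eig; rewrite -{1 2}(subrK (proj e f) f) addrC.
set r := f - proj e f.
have bpg g : b (proj e f) g = \sum_i l i * rip (ip f (e i) *: e i) g.
  rewrite (hform_suml hb); apply: eq_bigr => i _.
  by rewrite (hform_conj hb) eig (hform_conj rip_hform).
rewrite (hform_sqrD hb) bpg bpg; congr (_ + _).
rewrite [X in 2 * X]big1 ?mulr0 ?addr0 => [|i _].
  apply: eq_bigr => i _; rewrite /rip linearZl_LR /= (ipC (e i)) ip_proj.
  by rewrite Re_mul_conj.
by rewrite /rip linearZl_LR /= (ipC (e i)) ip_residual conjC0 mulr0 raddf0 mulr0.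
Qed.

Lemma bessel f : \sum_i sqabs (ip f (e i)) <= rip f f.
Proof.
rewrite [leRHS](hform_eigen_pythagoras (l := fun=> 1) f rip_hform); last first.
  by move=> i; exact: eigenvec_rip.
under [in leRHS]eq_bigr do rewrite mul1r.
by rewrite lerDl rip_ge0.
Qed.

Lemma rip_orthonormal i : rip (e i) (e i) = 1.
Proof. by rewrite /rip one eqxx. Qed.

End Orthonormal.

Lemma orthonormal_option (I : finType) (e : I -> H) f : orthonormal_family e ->
  ip f f = 1 -> (forall i, ip f (e i) = 0) ->
  orthonormal_family (fun o : option I => if o is Some i then e i else f).
Proof.
move=> one f1 fe [i|] [j|] //=.
by rewrite ipC fe conjC0.
Qed.

Lemma sqabs_ip_le f g : rip g g = 1 -> sqabs (ip f g) <= rip f f.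
Proof.
move=> g1; have one : orthonormal_family (fun _ : unit => g).
  by move=> [] []; rewrite eqxx ip_rip g1.
by have := bessel one f; rewrite big_const card_unit /= addr0.
Qed.

End HilbertSpace.

Lemma big_option (T : Type) (x0 : T) (op : Monoid.com_law x0) (I : finType)
    (F : option I -> T) :
  \big[op/x0]_o F o = op (F None) (\big[op/x0]_i F (Some i)).
Proof.
rewrite (bigD1 None) //=; congr (op _ _).
rewrite (reindex_omap Some id) //=; last by case.
by apply: eq_bigl => i; rewrite eqxx.
Qed.

(** * Spectral families of trace-bounded forms *)

(** The image ultrafilter contains a compact segment, hence clusters at some [z]; an ultrafilter
    contains every ball around a cluster point. *)
Lemma ultrafilter_oscillation (R : realType) (T : Type) (U : set_system T)
    (phi : T -> R) (c : R) : UltraFilter U -> U [set x | `|phi x| <= c] ->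
  forall eps, 0 < eps -> exists2 Q, U Q &
    forall x y, Q x -> Q y -> `|phi x - phi y| < eps.
Proof.
move=> UU Ubnd eps e0; have e20 : 0 < eps / 2 by rewrite divr_gt0.
have Fc : (phi @ U) `[(- c), c]%classic.
  apply: (@filterS _ U _ [set x | `|phi x| <= c]) => // x.
  by rewrite /= ler_norml in_itv.
have [z [_ clz]] := @segment_compact R (- c) c (phi @ U) _ Fc.
exists (phi @^-1` ball z (eps / 2)).
  have [//|Uc] := in_ultra_setVsetC (phi @^-1` ball z (eps / 2)) UU.
  have [r [nzr zr]] := clz (~` ball z (eps / 2)) (ball z (eps / 2)) Uc
    (nbhsx_ballx z _ e20).
  by case: nzr.
move=> x y; rewrite /ball /= => zx zy.
rewrite (_ : _ - _ = (phi x - z) + (z - phi y)); last by ring.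
rewrite (le_lt_trans (ler_normD _ _)) // [ltRHS]splitr ltrD // distrC.
exact: zx.
Qed.

Section Spectral.
Context (R : realType) (H : completeNormedModType R[i])
  (ip : {dot H for (@conjC R[i])}) (hilb : norm_from_dot ip).
Context (b A : H -> H -> R) (C : R) (hb : hform b) (hA : hform A)
  (b_le_A : forall f, `|b f f| <= A f f)
  (trace_A : forall (I : finType) (e : I -> H), orthonormal_family ip e ->
    \sum_i A (e i) (e i) <= C).
Implicit Types (f g h : H).
Local Notation rip := (rip ip).
Let hrip : hform rip := rip_hform ip.

Lemma normalize f : f != 0 -> exists r : R, let u := r%:C *: f in
  ip u u = 1 /\ forall b', hform b' -> b' f f = rip f f * b' u u.
Proof.
move=> f0; have r0 : 0 < rip f f.
  rewrite lt_neqAle rip_ge0 andbT eq_sym.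
  by apply: contra_neq f0; exact: rip_eq0.
exists (Num.sqrt (rip f f))^-1; split.
  rewrite ip_rip (hformZl hrip) (hformZr hrip) mulrA -expr2 exprVn.
  by rewrite sqr_sqrtr ?ltW // mulVf ?gt_eqF.
move=> b' hb'; rewrite (hformZl hb') (hformZr hb') [X in _ = _ * X]mulrA -expr2.
by rewrite exprVn sqr_sqrtr ?ltW // mulrA mulfV ?gt_eqF // mul1r.
Qed.

Lemma dominating_form_ge0 f : 0 <= A f f.
Proof. exact: le_trans (normr_ge0 _) (b_le_A f). Qed.

Definition orth (I : finType) (e : I -> H) f : Prop := forall i, ip f (e i) = 0.

Lemma orthD (I : finType) (e : I -> H) f g : orth e f -> orth e g -> orth e (f + g).
Proof. by move=> fe ge i; rewrite linearDl /= fe ge addr0. Qed.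
Lemma orthZ (I : finType) (e : I -> H) z f : orth e f -> orth e (z *: f).
Proof. by move=> fe i; rewrite linearZl_LR /= fe mulr0. Qed.
Lemma orthB (I : finType) (e : I -> H) f g : orth e f -> orth e g -> orth e (f - g).
Proof. by move=> fe ge i; rewrite linearBl /= fe ge subr0. Qed.

Lemma hform_le_orth (I : finType) (e : I -> H) b' c : hform b' ->
  (forall u, orth e u -> ip u u = 1 -> b' u u <= c) ->
  forall f, orth e f -> b' f f <= c * rip f f.
Proof.
move=> hb' le_c f fe; have [->|f0] := eqVneq f 0.
  by rewrite (hform0l hb') (hform0l hrip) mulr0.
have [r [u1 ->//]] := normalize f0.
by rewrite mulrC ler_wpM2r ?rip_ge0 // le_c //; exact: orthZ.
Qed.

(** Compactness in quantitative form: once a family has trace within [eps] of the supremum,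
    adjoining a unit vector orthogonal to it can add at most [eps]. *)
Lemma trace_tail eps : 0 < eps -> exists (I : finType) (e : I -> H),
  orthonormal_family ip e /\ forall f, orth e f -> A f f <= eps * rip f f.
Proof.
move=> eps0.
pose S := [set s | exists (I : finType) (e : I -> H),
  orthonormal_family ip e /\ s = \sum_i A (e i) (e i)].
have ubS : ubound S C by move=> _ [I [e [one ->]]]; exact: trace_A.
have supS : has_sup S.
  split; last by exists C.
  by exists 0, void, (fun=> 0); split; [case|rewrite big1 // => -[]].
have [_ [I [e [one ->]]] ltS] := sup_adherent eps0 supS.
exists I, e; split => //; apply: hform_le_orth => // u ue u1.
have := sup_upper_bound supS (ex_intro _ _ (ex_intro _ _
  (conj (orthonormal_option one u1 ue) erefl))).
by rewrite big_option /=; lra.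
Qed.

Lemma dominating_form_le f : A f f <= C * rip f f.
Proof.
apply: (@hform_le_orth void (fun=> 0)) => //.
move=> u _ u1; have := @trace_A unit (fun=> u) _.
by rewrite big_const card_unit /= addr0; apply => -[] []; rewrite eqxx u1.
Qed.

Lemma trace_bound_ge0 : 0 <= C.
Proof.
have := @trace_A void (fun=> 0) _; rewrite big1; first by apply => -[].
by case.
Qed.

Lemma rip_residual_le (I : finType) (e : I -> H) f : orthonormal_family ip e ->
  rip (f - proj ip e f) (f - proj ip e f) <= rip f f.
Proof.
move=> one; rewrite [leRHS](hform_eigen_pythagoras one (l := fun=> 1) f hrip).
  by rewrite lerDr sumr_ge0 // => i _; rewrite mul1r sqabs_ge0.
by move=> i; exact: eigenvec_rip.
Qed.

(** The parallelogram law splits [f] into projection and residual; [C] bounds [A] on the first and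
    [eps] on the second. Up to a small error, finitely many coordinates control [b] from above. *)
Lemma b_le_tail (I : finType) (e : I -> H) eps f : orthonormal_family ip e ->
  (forall g, orth e g -> A g g <= eps * rip g g) -> 0 <= eps ->
  b f f <= 2 * C * (\sum_i sqabs (ip f (e i))) + 2 * eps * rip f f.
Proof.
move=> one tail eps0; set p := proj ip e f.
have Ep : rip p p = \sum_i sqabs (ip f (e i)).
  rewrite (hform_eigen_pythagoras one (l := fun=> 1) p hrip); last first.
    by move=> i; exact: eigenvec_rip.
  have -> : p - proj ip e p = 0.
    by apply/eqP; rewrite subr_eq0; apply/eqP; apply: eq_bigr => i _;
      rewrite ip_proj.
  rewrite (hform0l hrip) addr0; apply: eq_bigr => i _.
  by rewrite mul1r ip_proj.
have := ler_norm (b f f); have := b_le_A f.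
have : A f f <= 2 * A (f - p) (f - p) + 2 * A p p.
  by rewrite -{1 2}(subrK p f) hform_le_parallelogram // dominating_form_ge0.
have := dominating_form_le p; rewrite Ep.
have := tail (f - p) (fun i => ip_residual one f i).
have : eps * rip (f - p) (f - p) <= eps * rip f f.
  by rewrite ler_wpM2l // rip_residual_le.
lra.
Qed.

(** * Attainment of the supremum of the form on an orthogonal complement *)

Section Maximizer.
Context (J : finType) (e : J -> H) (one : orthonormal_family ip e).
Context (M : R) (M_gt0 : 0 < M)
  (b_le_M : forall g, orth e g -> b g g <= M * rip g g).

(** The defect from maximality: nonnegative orthogonally to [e], and below [d] at the unit vectors
    of [near_max d]. *)
Let s f g := M * rip f g - b f g.
Let hs : hform s.
Proof. exact/hformB/hb/hformMl. Qed.
Let s_ge0 f : orth e f -> 0 <= s f f.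
Proof. by move=> ef; rewrite subr_ge0 b_le_M. Qed.
Let s_parallelogram f g : orth e f -> orth e g ->
  s (f - g) (f - g) <= 2 * s f f + 2 * s g g.
Proof.
move=> ef eg; have := hform_parallelogram hs f g.
by have := s_ge0 (orthD ef eg); lra.
Qed.

Let near_max (d : R) : set H :=
  [set u | [/\ orth e u, ip u u = 1 & M - d < b u u]].

(* The parallelogram law bounds s (f - g) for near maximizers f and g.  Since b
   is small off the span of finitely many vectors, this bounds M |f - g|^2 by
   the coordinates of f - g on them, which converge along an ultrafilter. *)
Lemma near_max_cauchy (U : set_system H) : UltraFilter U ->
  (forall d, 0 < d -> U (near_max d)) -> forall eta, 0 < eta ->
  exists2 P, U P & forall f g, P f -> P g -> rip (f - g) (f - g) < eta.
Proof.
move=> UU Umax eta eta0.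
(* The tail then contributes [M / 4] times the squared distance, which is absorbed on the left;
   [kap] and [d] keep the other two contributions below [M * eta / 8] each. *)
have M40 : 0 < M / 8 by rewrite divr_gt0.
have [I [e' [one' tail]]] := trace_tail M40.
pose c := 4 * C * #|I|%:R.
have c0 : 0 <= c by rewrite !mulr_ge0 // ?trace_bound_ge0.
(* The bound by 1 yields [x ^+ 2 <= kap] from [|x| < kap]; [c] may be 0, whence [c + 1]. *)
pose kap := Num.min 1 (M * eta / 8 / (c + 1)).
have kap0 : 0 < kap.
  by rewrite lt_min ltr01 !divr_gt0 ?mulr_gt0 // ltr_wpDl.
have kap1 : kap <= 1 by rewrite ge_min lexx.
have kapc : c * kap <= M * eta / 8.
  have : kap <= M * eta / 8 / (c + 1) by rewrite ge_min lexx orbT.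
  by rewrite ler_pdivlMr ?ltr_wpDl // mulrDr mulr1; lra.
have Ubnd i : U [set u | `|complex.Re (ip u (e' i))| <= 1] /\
              U [set u | `|complex.Im (ip u (e' i))| <= 1].
  have h u : near_max 1 u -> sqabs (ip u (e' i)) <= 1.
    move=> [_ u1 _]; rewrite (le_trans (sqabs_ip_le u _)) /rip ?u1 //.
    by rewrite one' eqxx.
  split; apply: filterS (Umax _ ltr01) => u /h; rewrite /sqabs /= => h1.
    rewrite -(@ler_pXn2r _ 2) ?nnegrE // real_normK ?num_real // expr1n.
    by apply: le_trans h1; rewrite lerDl sqr_ge0.
  rewrite -(@ler_pXn2r _ 2) ?nnegrE // real_normK ?num_real // expr1n.
  by apply: le_trans h1; rewrite lerDr sqr_ge0.
have osc i : exists Q : set H, U Q /\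
    forall f g, Q f -> Q g -> sqabs (ip (f - g) (e' i)) <= 2 * kap.
  have [Q1 UQ1 Q1P] := ultrafilter_oscillation UU (Ubnd i).1 kap0.
  have [Q2 UQ2 Q2P] := ultrafilter_oscillation UU (Ubnd i).2 kap0.
  exists (Q1 `&` Q2); split; first exact: filterI.
  move=> f g [Q1f Q2f] [Q1g Q2g].
  have sq x : `|x| < kap -> x ^+ 2 <= kap.
    move=> /ltW xk; rewrite -real_normK ?num_real // expr2.
    by rewrite -[leRHS]mul1r ler_pM // (le_trans xk).
  rewrite /sqabs linearBl /= mulr_natl mulr2n lerD // sq // raddfB.
    exact: Q1P.
  exact: Q2P.
have [Q QP] := choice osc.
pose d := M * eta / 32.
have d0 : 0 < d by rewrite divr_gt0 ?mulr_gt0.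
exists (near_max d `&` [set u | forall i, Q i u]).
  apply: filterI; first exact: Umax.
  by apply: filter_forall => i; have [] := QP i.
move=> f g [[ef f1 bf] Qf] [[eg g1 bg] Qg].
have := s_parallelogram ef eg; rewrite /s.
have -> : rip f f = 1 by rewrite /rip f1.
have -> : rip g g = 1 by rewrite /rip g1.
have := b_le_tail (f - g) one' tail (ltW M40).
set sum := \sum_i _.
have : 2 * C * sum <= c * kap.
  rewrite (_ : c * kap = 2 * C * (\sum_(i : I) (2 * kap))).
    by rewrite ler_wpM2l ?mulr_ge0 ?trace_bound_ge0 // ler_sum // => i _; apply: (QP i).2.
  by rewrite sumr_const -[in RHS]mulr_natr /c; ring.
have Me := mulr_gt0 M_gt0 eta0.
rewrite /d in bf bg => h1 h2 h3.
have : M * rip (f - g) (f - g) < M * eta by lra.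
by rewrite ltr_pM2l.
Qed.

(** The near maximizers generate a filter; an ultrafilter refining it is Cauchy, and its limit in
    the complete space [H] attains the maximum after normalization. *)
Lemma maximizer : (forall d, 0 < d -> near_max d !=set0) ->
  exists f, [/\ orth e f, ip f f = 1 & s f f = 0].
Proof.
move=> max_n0.
pose F := filter_from [set d : R | 0 < d] near_max.
have FF : ProperFilter F.
  apply: filter_from_proper => //; apply: filter_from_filter;
    first by exists 1; exact: ltr01.
  move=> d d' /= d0 d'0; exists (Num.min d d'); first by rewrite /= lt_min d0.
  by move=> u [eu u1 bu]; split; split=> //; apply: le_lt_trans bu;
    rewrite lerB // ge_min lexx ?orbT.
have [U [UU FU]] := ultraFilterLemma FF.
have Umax d : 0 < d -> U (near_max d) by move=> d0; apply: FU; exists d.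
have /cauchy_cvg /cvg_ex [f Uf] : cauchy U.
  (* The radius is a positive element of [R[i]], hence real. *)
  apply/cauchy_ballP => eps; rewrite ltcE /= => /andP[/eqP epsi eps0].
  have [P UP Posc] := near_max_cauchy UU Umax (exprn_gt0 2 eps0).
  exists (P, P) => // -[x y] [Px Py] /=.
  rewrite -ball_normE /ball_ /= (norm_rip hilb) ltcE /= epsi eqxx /=.
  rewrite -[ltRHS]ger0_norm ?ltW // -sqrtr_sqr ltr_sqrt ?exprn_gt0 //.
  exact: Posc.
have app d : 0 < d -> exists g,
    [/\ orth e g, ip g g = 1, M - d < b g g & rip (f - g) (f - g) < d].
  move=> d0; have sd0 : 0 < (Num.sqrt d)%:C by rewrite ltcR sqrtr_gt0.
  have [g [[eg g1 bg] fg]] := @filter_ex _ U _ _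
    (filterI (Umax d d0) (Uf _ (nbhsx_ballx f _ sd0))).
  exists g; split=> //; move: fg; rewrite -ball_normE /ball_ /=.
  by rewrite (norm_rip hilb) ltcR ltr_sqrt.
have ef : orth e f.
  move=> i; have : sqabs (ip f (e i)) <= 0.
    apply/ler_addgt0Pr => d d0; have [g [eg _ _ fg]] := app d d0.
    rewrite add0r (le_trans _ (ltW fg)) //.
    rewrite (_ : ip f (e i) = ip (f - g) (e i)); last first.
      by rewrite linearBl /= eg subr0.
    by rewrite sqabs_ip_le // /rip one eqxx.
  case: (ip f (e i)) => x y; rewrite /sqabs /= => xy.
  apply/eqP; rewrite eq_complex /= -[x == 0]sqrf_eq0 -[y == 0]sqrf_eq0.
  by rewrite -paddr_eq0 ?sqr_ge0 // eq_le xy addr_ge0 ?sqr_ge0.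
have sf0 : s f f = 0.
  apply/le_anti/andP; split; last exact: s_ge0.
  apply/ler_addgt0Pr => d d0.
  have C0 := trace_bound_ge0.
  (* For a [k]-approximation [g] of [f], the defect of [f] is at most twice that of [f - g], itself
     at most [(M + C) * k], plus twice that of [g], below [k]. *)
  have D0 : 0 < 2 + 2 * M + 2 * C by move: C0 M_gt0; lra.
  have [g [eg g1 bg fg]] := app (d / (2 + 2 * M + 2 * C)) (divr_gt0 d0 D0).
  set k := d / _ in bg fg.
  have kE : d = k * (2 + 2 * M + 2 * C) by rewrite /k divfK ?gt_eqF.
  rewrite -{1 2}(subrK g f).
  have /le_trans-> // : s (f - g + g) (f - g + g) <=
      2 * s (f - g) (f - g) + 2 * s g g.
    by apply: (hform_le_parallelogram hs); exact: s_ge0 (orthB (orthB ef eg) eg).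
  rewrite {2}/s (_ : rip g g = 1) ?mulr1; last by rewrite /rip g1.
  have : s (f - g) (f - g) <= (M + C) * rip (f - g) (f - g).
    rewrite /s mulrDl lerD2l; apply: le_trans (dominating_form_le _).
    by rewrite (le_trans (ler_norm _)) // normrN.
  have : (M + C) * rip (f - g) (f - g) <= (M + C) * k.
    by rewrite ler_wpM2l ?ltW //; move: C0 M_gt0; lra.
  by rewrite kE add0r; lra.
(* The norm of the limit is not computed: a unit vector at squared distance below 1 excludes
   [f = 0], and [f] is rescaled. *)
have f0 : f != 0.
  apply/eqP => f0; have [g [_ g1 _]] := app 1 ltr01.
  by rewrite f0 sub0r (hformNl hrip) (hformNr hrip) opprK /rip g1 ltxx.
have [r [u1 uE]] := normalize f0.
exists (r%:C *: f); split => //; first exact: orthZ.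
move: sf0; rewrite (uE s hs) => /eqP; rewrite mulf_eq0 => /orP[/eqP/rip_eq0|/eqP//].
by move/eqP; rewrite (negbTE f0).
Qed.

End Maximizer.

Definition eigenfamily a (I : finType) (e : I -> H) (l : I -> R) : Prop :=
  [/\ orthonormal_family ip e, forall i, eigenvec ip b (e i) (l i)
    & forall i, a < l i].

Definition spectral_family a (I : finType) (e : I -> H) (l : I -> R) : Prop :=
  eigenfamily a e l /\ forall f, orth e f -> b f f <= a * rip f f.

(** Each member contributes at least [a] to the trace of [A], so for [a > 0] the families have
    bounded size. *)
Lemma eigenfamily_card a (I : finType) (e : I -> H) (l : I -> R) :
  eigenfamily a e l -> #|I|%:R * a <= C.
Proof.
move=> [one eig la]; apply: le_trans (trace_A one).
rewrite mulr_natl -sumr_const ler_sum // => i _; apply: le_trans (b_le_A _).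
apply: le_trans (ler_norm _).
by rewrite eig (rip_orthonormal one) mulr1 ltW.
Qed.

(** The defect form is nonnegative orthogonally to [e] and vanishes at [f], so [hform_eq0] kills it
    against that complement; against the [e i] both of its terms vanish, since these are
    eigenvectors orthogonal to [f]. *)
Lemma maximizer_eigenvec (J : finType) (e : J -> H) (l : J -> R) M f :
  orthonormal_family ip e -> (forall i, eigenvec ip b (e i) (l i)) ->
  (forall g, orth e g -> b g g <= M * rip g g) ->
  orth e f -> M * rip f f - b f f = 0 -> eigenvec ip b f M.
Proof.
move=> one eig b_le_M ef sf g.
pose s f g := M * rip f g - b f g.
have hs : hform s by exact/hformB/hb/hformMl.
have bp : s f (proj ip e g) = 0.
  rewrite (hformC hs) (hform_suml hs) big1 // => i _; rewrite /s.
  rewrite (hform_conj hb) eig -(hform_conj hrip) (hformC hrip).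
  by rewrite {1 2}/rip linearZr_LR /= ef mulr0 raddf0 !mulr0 subrr.
have : s f (g - proj ip e g) = 0.
  apply: (hform_eq0 hs) => // r; rewrite /s subr_ge0; apply: b_le_M.
  by apply: orthD; [move=> i; exact: ip_residual|exact: orthZ].
by rewrite (hformBr hs) bp subr0 => /subr0_eq.
Qed.

(** An eigenfamily of maximal size works: if the form exceeded [a] at a unit vector orthogonal to
    it, the maximizer there would be one more eigenvector, with eigenvalue [sup S > a]. *)
Theorem spectral_family_exists a : 0 < a ->
  exists (I : finType) (e : I -> H) (l : I -> R), spectral_family a e l.
Proof.
move=> a0.
pose Q n := `[< exists (I : finType) (e : I -> H) (l : I -> R),
  #|I| = n /\ eigenfamily a e l >].
have Q0 : exists n, Q n.
  exists 0%N; apply/asboolP; exists void, (fun=> 0), (fun=> 0).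
  by split; [rewrite card_void|split; case].
have Qb n : Q n -> (n <= Num.bound (C / a))%N.
  move/asboolP => [I [e [l [<- /eigenfamily_card]]]].
  rewrite -ler_pdivlMr // => nC; rewrite -(ler_nat R) (le_trans nC) // ltW //.
  exact: archi_boundP (divr_ge0 trace_bound_ge0 (ltW a0)).
case: (ex_maxnP Q0 Qb) => n /asboolP[I [e [l [In [one eig la]]]]] maxn.
exists I, e, l; split=> //; apply: hform_le_orth => // u0 eu0 u01.
rewrite leNgt; apply/negP => a_lt.
pose S := [set x | exists u, [/\ orth e u, ip u u = 1 & x = b u u]].
have supS : has_sup S.
  split; first by exists (b u0 u0), u0.
  exists C => _ [u [_ u1 ->]]; apply: le_trans (ler_norm _) _.
  by apply: le_trans (b_le_A _) _; have := dominating_form_le u; rewrite /rip u1 mulr1.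
have a_lt_sup : a < sup S.
  by apply: (lt_le_trans a_lt); apply: (sup_upper_bound supS); exists u0.
have b_le_sup g : orth e g -> b g g <= sup S * rip g g.
  apply: hform_le_orth => // u eu u1; apply: (sup_upper_bound supS).
  by exists u.
have [] := maximizer one (lt_trans a0 a_lt_sup) b_le_sup.
  move=> d d0; have [_ [u [eu u1 ->]] ltb] := sup_adherent d0 supS.
  by exists u.
move=> f [ef f1 sf].
have /maxn : Q n.+1; last by rewrite ltnn.
apply/asboolP; exists (option I),
  (fun o => if o is Some i then e i else f),
  (fun o => if o is Some i then l i else sup S).
split; first by rewrite card_option In.
split; first exact: orthonormal_option.
- by move=> [i|] //; exact: maximizer_eigenvec sf.
- by move=> [i|].
Qed.

End Spectral.

(** * Toeplitz forms *)

Section RealIntegrable.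
Context d (T : measurableType d) (R : realType)
  (mu : {measure set T -> \bar R}).
Implicit Types f g h : T -> R.

Definition L1 f : Prop := mu.-integrable [set: T] (EFin \o f).

Lemma L1_measurable f : L1 f -> measurable_fun [set: T] f.
Proof. by move=> /integrableP[/measurable_EFinP]. Qed.

Lemma L1_le f g : measurable_fun [set: T] f -> (forall x, `|f x| <= g x) ->
  L1 g -> L1 f.
Proof.
move=> mf fg; apply: le_integrable => //; first exact/measurable_EFinP.
by move=> x _; rewrite /= lee_fin (le_trans (fg x)) // ler_norm.
Qed.

Lemma eq_L1 f g : f =1 g -> L1 f -> L1 g.
Proof. by move=> fg; apply: eq_integrable => // x _ /=; rewrite fg. Qed.

Lemma L1D f g : L1 f -> L1 g -> L1 (fun x => f x + g x).
Proof. by move=> Lf Lg; have := integrableD measurableT Lf Lg. Qed.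

Lemma L1Z (c : R) f : L1 f -> L1 (fun x => c * f x).
Proof. by move=> Lf; have := integrableZl measurableT c Lf. Qed.

Lemma L1B f g : L1 f -> L1 g -> L1 (fun x => f x - g x).
Proof.
move=> Lf Lg; apply: eq_L1 (L1D Lf (L1Z (-1) Lg)) => x.
by rewrite mulN1r.
Qed.

Lemma L1_norm f : L1 f -> L1 (fun x => `|f x|).
Proof. exact: integrable_norm. Qed.

Lemma L1M f h (c : R) : L1 f -> measurable_fun [set: T] h ->
  (forall x, `|h x| <= c) -> L1 (fun x => f x * h x).
Proof.
move=> Lf mh hc.
apply: (@L1_le _ (fun x => c * `|f x|)); last exact/L1Z/L1_norm.
  by apply: measurable_funM => //; exact: L1_measurable.
by move=> x; rewrite normrM mulrC ler_wpM2r.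
Qed.

Lemma L1_sum (I : finType) (F : I -> T -> R) : (forall i, L1 (F i)) ->
  L1 (fun x => \sum_i F i x).
Proof.
move=> LF; have := integrable_sum measurableT (index_enum I) (P := xpredT)
  (fun i _ => LF i).
by apply: eq_integrable => // x _ /=; rewrite sumEFin.
Qed.

Definition Rint f : R := \int[mu]_x f x.

Lemma eq_Rint f g : f =1 g -> Rint f = Rint g.
Proof. by move=> fg; apply: eq_Rintegral => x _. Qed.

Lemma le_Rint f g : L1 f -> L1 g -> (forall x, f x <= g x) -> Rint f <= Rint g.
Proof. by move=> Lf Lg fg; apply: le_Rintegral. Qed.

Lemma RintD f g : L1 f -> L1 g -> Rint (fun x => f x + g x) = Rint f + Rint g.
Proof. by move=> Lf Lg; exact: RintegralD. Qed.

Lemma RintB f g : L1 f -> L1 g -> Rint (fun x => f x - g x) = Rint f - Rint g.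
Proof. by move=> Lf Lg; exact: RintegralB. Qed.

Lemma RintZ c f : L1 f -> Rint (fun x => c * f x) = c * Rint f.
Proof. by move=> Lf; exact: RintegralZl. Qed.

Lemma Rint_sum (I : finType) (F : I -> T -> R) : (forall i, L1 (F i)) ->
  Rint (fun x => \sum_i F i x) = \sum_i Rint (F i).
Proof.
move=> LF; apply: EFin_inj; rewrite -sumEFin /Rint /Rintegral.
rewrite fineK; last by apply: integrable_fin_num => //; exact: L1_sum.
rewrite (eq_integral (fun x => \sum_i (EFin \o F i) x)%E); last first.
  by move=> x _ /=; rewrite sumEFin.
rewrite integral_sum //; apply: eq_bigr => i _.
by rewrite fineK //; exact: integrable_fin_num (LF i).
Qed.

Lemma Rint_EFin f : L1 f -> (\int[mu]_x (f x)%:E)%E = (Rint f)%:E.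
Proof.
by move=> Lf; rewrite /Rint /Rintegral fineK //; exact: integrable_fin_num.
Qed.

Lemma Rint_ge0 f : (forall x, 0 <= f x) -> 0 <= Rint f.
Proof. by move=> f0; apply: Rintegral_ge0. Qed.

End RealIntegrable.

Section FrameForms.
Context (R : realType) (H : completeNormedModType R[i])
  (ip : {dot H for (@conjC R[i])}) (hilb : norm_from_dot ip).
Context d (T : measurableType d) (mu : {measure set T -> \bar R}) (k : T -> H)
  (frame : normalized_parseval_frame ip mu k).
Implicit Types (f g h : H) (s : T -> R).
Local Notation rip := (rip ip).
Local Notation L1 := (L1 mu).
Local Notation Rint := (Rint mu).

Lemma frame_unit x : ip (k x) (k x) = 1.
Proof. by case: frame => k1 _ _; rewrite -hilb k1 expr1n. Qed.

Lemma frame_rip x : rip (k x) (k x) = 1.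
Proof. by rewrite /rip frame_unit. Qed.

Definition frame_pair f g x : R :=
  complex.Re (ip f (k x) * conjC (ip g (k x))).

Lemma frame_pairE f g x : frame_pair f g x =
  complex.Re (ip f (k x)) * complex.Re (ip g (k x)) +
  complex.Im (ip f (k x)) * complex.Im (ip g (k x)).
Proof.
by rewrite /frame_pair; case: (ip f _) => a b; case: (ip g _) => a' b' /=; ring.
Qed.

Lemma frame_pair_hform x : hform (fun f g => frame_pair f g x).
Proof.
split=> *; rewrite /frame_pair.
- by rewrite linearDl mulrDl raddfD.
- by rewrite -Re_conj rmorphM /= conjCK mulrC.
- by rewrite linearZl_LR -mulrA Re_realM.
- by rewrite !linearZl_LR /= rmorphM /= conjCK [in RHS]mulrCA.
Qed.

Lemma frame_pair_sqabs f x : frame_pair f f x = sqabs (ip f (k x)).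
Proof. exact: Re_mul_conj. Qed.

Lemma frame_pair_le f g x : `|frame_pair f g x| <= rip f f + rip g g.
Proof.
have le_f f' : sqabs (ip f' (k x)) <= rip f' f'.
  by rewrite sqabs_ip_le // frame_rip.
apply: le_trans (lerD (le_f f) (le_f g)); rewrite frame_pairE /sqabs.
set a := complex.Re _; set b := complex.Im _.
set a' := complex.Re (ip g _); set b' := complex.Im (ip g _).
rewrite ler_norml; apply/andP; split.
  by have := sqr_ge0 (a + a'); have := sqr_ge0 (b + b');
     have := sqr_ge0 (a - a'); have := sqr_ge0 (b - b'); nra.
by have := sqr_ge0 (a + a'); have := sqr_ge0 (b + b');
   have := sqr_ge0 (a - a'); have := sqr_ge0 (b - b'); nra.
Qed.

Lemma measurable_frame_pair f g : measurable_fun [set: T] (frame_pair f g).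
Proof.
case: frame => _ mk _; have [mfr mfi] := mk f; have [mgr mgi] := mk g.
rewrite (funext (frame_pairE f g)).
exact: measurable_funD (measurable_funM mfr mgr) (measurable_funM mfi mgi).
Qed.

Lemma L1_frame_pair s f g : L1 s -> L1 (fun x => s x * frame_pair f g x).
Proof.
move=> Ls; apply: L1M (measurable_frame_pair f g) _ => //.
exact: frame_pair_le.
Qed.

Lemma parseval_sqabs f :
  L1 (fun x => sqabs (ip f (k x))) /\ Rint (fun x => sqabs (ip f (k x))) = rip f f.
Proof.
case: frame => _ _ /(_ f f)[[intr _] eqf].
have E x : complex.Re (ip (ip f (k x) *: k x) f) = sqabs (ip f (k x)).
  by rewrite linearZl_LR /= (ipC _ (k x)) Re_mul_conj.
split; first by apply: eq_L1 intr => x; exact: E.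
by rewrite /rip eqf /=; apply: eq_Rint => x; rewrite E.
Qed.

(** The real part of <T f, g> as an ordinary integral; the spectral theory is run on it without any
    weak integral. *)
Definition toeplitz_form s f g : R := Rint (fun x => s x * frame_pair f g x).

Lemma toeplitz_form_diag s f :
  toeplitz_form s f f = Rint (fun x => s x * sqabs (ip f (k x))).
Proof. by apply: eq_Rint => x; rewrite frame_pair_sqabs. Qed.

Lemma L1_sqabs s f : L1 s -> L1 (fun x => s x * sqabs (ip f (k x))).
Proof.
by move/(L1_frame_pair f f); apply: eq_L1 => x; rewrite frame_pair_sqabs.
Qed.

Lemma toeplitz_hform s : L1 s -> hform (toeplitz_form s).
Proof.
move=> Ls; rewrite /toeplitz_form; split=> *.
- rewrite -RintD; try exact: L1_frame_pair.
  by apply: eq_Rint => x; rewrite (hformDl (frame_pair_hform x)) mulrDr.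
- by apply: eq_Rint => x; rewrite (hformC (frame_pair_hform x)).
- rewrite -RintZ; last exact: L1_frame_pair.
  by apply: eq_Rint => x; rewrite (hformZl (frame_pair_hform x)) mulrCA.
- by apply: eq_Rint => x; rewrite (hform_conj (frame_pair_hform x)).
Qed.

Lemma toeplitz_form_norm s f : L1 s ->
  `|toeplitz_form s f f| <= toeplitz_form (fun x => `|s x|) f f.
Proof.
move=> Ls; rewrite !toeplitz_form_diag.
apply: le_trans (le_normr_Rintegral measurableT (L1_sqabs f Ls)) _.
rewrite le_eqVlt; apply/orP; left; apply/eqP; apply: eq_Rint => x.
by rewrite normrM (ger0_norm (sqabs_ge0 _)).
Qed.

(** After exchanging sum and integral, Bessel's inequality at the unit vector [k x] bounds the
    weight of [s x] by 1. *)
Lemma toeplitz_trace_le s (I : finType) (e : I -> H) : L1 s ->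
  (forall x, 0 <= s x) -> orthonormal_family ip e ->
  \sum_i toeplitz_form s (e i) (e i) <= Rint s.
Proof.
move=> Ls s0 one; under eq_bigr do rewrite toeplitz_form_diag.
rewrite -Rint_sum; last by move=> i; exact: L1_sqabs.
apply: le_Rint => //; first by apply: L1_sum => i; exact: L1_sqabs.
move=> x; rewrite -mulr_sumr -[leRHS]mulr1 ler_wpM2l // -(frame_rip x).
apply: le_trans (bessel one (k x)).
by apply: ler_sum => i _; rewrite ipC sqabs_conj.
Qed.

Theorem toeplitz_spectral_family s a : L1 s -> 0 < a ->
  exists (I : finType) (e : I -> H) (l : I -> R),
    spectral_family ip (toeplitz_form s) a e l.
Proof.
move=> Ls a0; have La := L1_norm Ls.
apply: (spectral_family_exists hilb (A := toeplitz_form (fun x => `|s x|))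
  (C := Rint (fun x => `|s x|))) => //.
- exact: toeplitz_hform.
- exact: toeplitz_hform.
- by move=> f; exact: toeplitz_form_norm.
- by move=> I e one; exact: toeplitz_trace_le.
Qed.

End FrameForms.

(** * Counting eigenvalues *)

Lemma esum_card (R : realType) (I : finType) (l : I -> R) (D : set R) :
  (\esum_(x in D) (#|[pred i | l i == x]|%:R)%:E =
   (#|[pred i | l i \in D]|%:R)%:E :> \bar R)%E.
Proof.
have card1 (P : pred I) :
    (#|P|%:R)%:E = (\sum_i (if P i then 1 else 0))%E :> \bar R.
  rewrite -[RHS]big_mkcond /= (eq_bigr (fun=> (1%:R)%:E)) // sumEFin.
  by rewrite -natr_sum sum1_card.
under eq_esum do rewrite card1.
rewrite esum_sum; last by move=> x i _ _; case: ifP.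
rewrite card1; apply: eq_bigr => i _.
transitivity (\esum_(x in D `&` [set l i]) (1 : \bar R))%E.
  rewrite esum_mkcondr; apply: eq_esum => x _.
  by rewrite /= in_set1 eq_sym.
case: ifPn => [/set_mem Dli|/negP nDli].
  by rewrite setIidr ?esum_set1 // => _ ->.
rewrite (_ : _ `&` _ = set0) ?esum_set0 // -subset0 => x [Dx xl].
by apply: nDli; rewrite inE /= -xl inE.
Qed.

(** A coefficient matrix with more rows than columns has a nonzero left kernel vector, which is a
    linear relation among the [f j]. *)
Lemma lin_dep_of_span (R : realType) (H : completeNormedModType R[i])
    m n (e : 'I_m -> H) (f : 'I_n -> H) (a : 'I_n -> 'I_m -> R[i]) :
  (forall j, f j = \sum_i a j i *: e i) -> lin_indep f -> (n <= m)%N.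
Proof.
move=> fE indep; rewrite leqNgt; apply/negP => mn.
pose M := \matrix_(j < n, i < m) a j i.
have : ~~ row_free M.
  by rewrite -row_leq_rank -ltnNge (leq_ltn_trans (rank_leq_col _)).
rewrite -kermx_eq0 => /rowV0Pn[v /sub_kermxP vM0 v0].
case/negP: v0; apply/eqP/rowP => j; rewrite mxE.
apply: (indep (v 0)).
under eq_bigr do rewrite fE scaler_sumr.
rewrite exchange_big big1 //= => i _.
under eq_bigr do rewrite scalerA.
rewrite -scaler_suml (_ : \sum_i _ = (v *m M) 0 i).
  by rewrite vM0 mxE scale0r.
by rewrite mxE; apply: eq_bigr => j' _; rewrite mxE.
Qed.

Section EigenvalueCount.
Context (R : realType) (H : completeNormedModType R[i])
  (ip : {dot H for (@conjC R[i])}) (hilb : norm_from_dot ip).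
Context d (T : measurableType d) (mu : {measure set T -> \bar R}) (k : T -> H)
  (frame : normalized_parseval_frame ip mu k).
Context (s : T -> R) (Ls : L1 mu s).
Local Notation B := (toeplitz_form ip mu k s).
Local Notation Ts := (toeplitz ip mu k s).

Let integrand f x := ((s x)%:C * ip f (k x)) *: k x.

Let ip_integrand f g x : ip (integrand f x) g =
  (s x * frame_pair ip k f g x) +i* (s x * frame_pair ip k f ('i *: g) x).
Proof.
rewrite /integrand linearZl_LR -mulrA /= (ipC ip (k x)).
apply/eqP; rewrite eq_complex Re_realM Im_realM /= eqxx /=.
rewrite /frame_pair linearZl_LR rmorphM /=.
by case: (ip f _) => a b; case: (ip g _) => a' b' /=; apply/eqP; ring.
Qed.

Lemma cintegrable_integrand f g : cintegrable mu (fun x => ip (integrand f x) g).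
Proof.
split.
  by apply: eq_L1 (L1_frame_pair hilb frame f g Ls) => x; rewrite ip_integrand.
apply: eq_L1 (L1_frame_pair hilb frame f ('i *: g) Ls) => x.
by rewrite ip_integrand.
Qed.

Lemma cintegral_integrand f g :
  cintegral mu (fun x => ip (integrand f x) g) = B f g +i* B f ('i *: g).
Proof.
by congr (_ +i* _); apply: eq_Rint => x; rewrite ip_integrand.
Qed.

(** The form sees real parts only; testing against ['i *: g] supplies the imaginary part. *)
Lemma weak_integral_eigenvec f (l : R) :
  is_weak_integral ip mu (integrand f) (l%:C *: f) <-> eigenvec ip B f l.
Proof.
split=> [wf g|eig g].
  have [_] := wf g; rewrite cintegral_integrand linearZl_LR /=.
  by move/(congr1 (@complex.Re R)); rewrite Re_realM.
split; first exact: cintegrable_integrand.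
rewrite cintegral_integrand !eig -rip_i linearZl_LR /=.
by apply/eqP; rewrite eq_complex Re_realM Im_realM !eqxx.
Qed.

Lemma weak_integral_unique (F : T -> H) u v :
  is_weak_integral ip mu F u -> is_weak_integral ip mu F v -> u = v.
Proof.
move=> Fu Fv; apply: (@rip_inj _ _ ip) => g.
by rewrite /rip (Fu g).2 (Fv g).2.
Qed.

(* As l <> 0, the default value 0 of weak_integral creates no eigenvector, so
   the weak integrals need not be shown to exist. *)
Lemma toeplitz_eigenvec f (l : R) : l != 0 ->
  Ts f = l%:C *: f <-> eigenvec ip B f l.
Proof.
move=> l0; rewrite /toeplitz /weak_integral.
split=> [|/weak_integral_eigenvec w].
  case: xgetP => [u _ wu ul|_ lf0].
    by apply/weak_integral_eigenvec; rewrite -ul.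
  have f0 : f = 0.
    apply/eqP; have := esym lf0 => /eqP; rewrite scaler_eq0.
    by rewrite eq_complex /= (negbTE l0).
  move=> g; rewrite f0 (hform0l (rip_hform ip)) mulr0.
  exact: (hform0l (toeplitz_hform hilb frame Ls)).
case: xgetP => [u _ wu|/(_ _ w)//].
exact: weak_integral_unique wu w.
Qed.

Context (a : R) (a_gt0 : 0 < a) (I : finType) (e : I -> H) (l : I -> R)
  (spec : spectral_family ip B a e l).

(** Eigenvectors for distinct eigenvalues are orthogonal, by symmetry of [B]. *)
Lemma eigenvec_coord f (x : R) i : eigenvec ip B f x -> l i != x ->
  ip f (e i) = 0.
Proof.
case: spec => [[one eig _] _] fx lx.
have hB := toeplitz_hform hilb frame Ls.
have rip0 z : rip ip f (z *: e i) = 0.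
  have : (x - l i) * rip ip f (z *: e i) = 0.
    rewrite mulrBl -fx (hformC hB) (hform_conj hB) eig.
    by rewrite -(hform_conj (rip_hform ip)) (hformC (rip_hform ip)) subrr.
  by move/eqP; rewrite mulf_eq0 subr_eq0 eq_sym (negbTE lx) => /eqP.
(* The imaginary part is the case [z = 'i], the real part the case [z = 1]. *)
apply/eqP; rewrite eq_complex rip_i rip0 eqxx andbT.
by have := rip0 1; rewrite scale1r /rip => ->.
Qed.

(** The residual [r] satisfies [B r r = x * rip ip r r], while off the family [B] is at most [a < x]
    times the squared norm; hence [r = 0]. *)
Lemma eigenvec_span f (x : R) : a < x -> eigenvec ip B f x ->
  f = proj ip e f.
Proof.
case: spec => [[one eig _] le_a] ax fx.
have hB := toeplitz_hform hilb frame Ls.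
have hr := rip_hform ip.
set r := f - proj ip e f.
have er : orth ip e r by move=> i; exact: ip_residual.
(* The disjunction lets one computation serve both [B] and [rip ip]. *)
have pr b : hform b -> (forall i, eigenvec ip b (e i) (l i)) \/ (b = rip ip) ->
    b (proj ip e f) r = 0.
  move=> hb eb; rewrite (hform_suml hb) big1 // => i _.
  have rip0 : rip ip (ip f (e i) *: e i) r = 0.
    by rewrite (hformC hr) /rip linearZr_LR /= er mulr0 raddf0.
  case: eb => [eb|->//].
  by rewrite (hform_conj hb) eb -(hform_conj hr) rip0 mulr0.
have Brr : B r r = x * rip ip r r.
  rewrite {1}/r (hformBl hB) (pr B) ?subr0; [|by []|by left].
  by rewrite fx {1}/r (hformBl hr) (pr (rip ip)) ?subr0; [|by []|by right].
have := le_a r er; rewrite Brr => xr.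
apply/subr0_eq/(@rip_eq0 _ _ ip)/le_anti; rewrite rip_ge0 andbT.
have := rip_ge0 ip r; rewrite -/r; nra.
Qed.

(** Eigenvectors for [x] lie in the span of those [e i] with [l i = x], which bounds the size of an
    independent family; these [e i] attain the bound. *)
Lemma multiplicityE (x : R) : a < x ->
  multiplicity Ts x%:C = (#|[pred i | l i == x]|%:R)%:E.
Proof.
move=> ax; have x0 : x != 0 by rewrite gt_eqF // (lt_trans a_gt0).
case: spec => [[one eig _] le_a].
set S := [pred i | l i == x].
apply/le_anti/andP; split.
  apply: ge_ereal_sup => _ [n [f [indep Tf]] <-].
  rewrite lee_fin ler_nat.
  apply: (@lin_dep_of_span _ _ _ _ (fun i : 'I_#|S| => e (enum_val i)) f
    (fun j i => ip (f j) (e (enum_val i)))) => // j.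
  have fx : eigenvec ip B (f j) x by apply/toeplitz_eigenvec.
  rewrite {1}(eigenvec_span ax fx) /proj.
  rewrite -(big_enum_val (fun i => ip (f j) (e i) *: e i)) /=.
  rewrite [RHS]big_mkcond /=; apply: eq_bigr => i _; case: ifPn => //.
  by rewrite inE => lx; rewrite (eigenvec_coord fx lx) scale0r.
apply: ereal_sup_ubound; exists #|S| => //.
exists (fun i => e (enum_val i)); split.
  move=> c c0 j; have : ip (\sum_i c i *: e (enum_val i)) (e (enum_val j)) = 0.
    by rewrite c0 linear0l.
  rewrite (@ip_comb _ _ ip _ (fun i => e (enum_val i))) //.
  by move=> i i'; rewrite one (inj_eq enum_val_inj).
move=> j; apply/toeplitz_eigenvec => //.
have := enum_valP j; rewrite inE => /eqP <-; exact: eig.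
Qed.

Lemma eigenvalue_countE (t : R) : a <= t ->
  eigenvalue_count Ts t = (#|[pred i | t < l i]|%:R)%:E.
Proof.
move=> at_; rewrite /eigenvalue_count.
rewrite (@eq_esum _ _ _ _ (fun x => (#|[pred i | l i == x]|%:R)%:E)); last first.
  by move=> x /= tx; apply: multiplicityE; exact: le_lt_trans tx.
rewrite esum_card; congr ((_%:R)%:E); apply: eq_card => i.
by rewrite !inE; apply/idP/idP; rewrite inE.
Qed.

End EigenvalueCount.

Section PositivePart.
Context d (T : measurableType d) (R : realType)
  (mu : {measure set T -> \bar R}) (s : T -> R) (Ls : L1 mu s).

Lemma L1_pos_part (t : R) : 0 <= t -> L1 mu (fun x => Num.max (s x - t) 0).
Proof.
move=> t0; apply: L1_le (L1_norm Ls).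
  apply: measurable_maxr; last exact: measurable_cst.
  by apply: measurable_funB; [exact: L1_measurable Ls|exact: measurable_cst].
move=> x; rewrite ger0_norm; last by rewrite le_max lexx orbT.
by rewrite ge_max normr_ge0 andbT; have := ler_norm (s x); lra.
Qed.

End PositivePart.

(** * Trace estimates *)

Section TraceEstimates.
Context (R : realType) (H : completeNormedModType R[i])
  (ip : {dot H for (@conjC R[i])}) (hilb : norm_from_dot ip).
Context d (T : measurableType d) (mu : {measure set T -> \bar R}) (k : T -> H)
  (frame : normalized_parseval_frame ip mu k).
Context (s : T -> R) (Ls : L1 mu s).
Local Notation B := (toeplitz_form ip mu k s).
Context (a : R) (I : finType) (e : I -> H) (l : I -> R)
  (spec : spectral_family ip B a e l).
Context (t : R) (t_ge0 : 0 <= t) (a_le_t : a <= t).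

(* The trace of the positive part of B - t, when m lists the eigenvalues of B
   above some threshold not exceeding t. *)
Definition excess (J : finType) (m : J -> R) : R := \sum_j Num.max (m j - t) 0.

(** Jensen's inequality: by Parseval the weights |<e_i, k_x>|^2 have integral 1, so [l i - t] is the
    weighted integral of [s - t], at most that of its positive part. The trace bound then sums over
    [i]. *)
Lemma excess_le :
  excess l <= Rint mu (fun x => Num.max (s x - t) 0).
Proof.
case: spec => [[one eig _] _].
pose p x := Num.max (s x - t) 0.
have Lp : L1 mu p by exact: L1_pos_part.
have p0 x : 0 <= p x by rewrite le_max lexx orbT.
apply: le_trans (toeplitz_trace_le hilb frame Lp p0 one).
apply: ler_sum => i _; rewrite toeplitz_form_diag ge_max; apply/andP; split.
  have [Lw Ew] := parseval_sqabs frame (e i).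
  have : B (e i) (e i) - t * rip ip (e i) (e i) <=
         Rint mu (fun x => p x * sqabs (ip (e i) (k x))).
    rewrite toeplitz_form_diag -Ew -RintZ // -RintB //; last 2 first.
    - exact: L1_sqabs.
    - exact: L1Z.
    apply: le_Rint => [||x].
    - by apply: L1B; [exact: L1_sqabs|exact: L1Z].
    - exact: L1_sqabs.
    by rewrite -mulrBl ler_wpM2r ?sqabs_ge0 // le_max lexx.
  by rewrite eig (rip_orthonormal one) !mulr1.
by apply: Rint_ge0 => x; rewrite mulr_ge0 ?sqabs_ge0.
Qed.

(** In the eigenvector decomposition of [f] the residual contributes at most 0, because there the
    form is at most [a <= t] times the squared norm. *)
Lemma form_le_excess f :
  B f f - t * rip ip f f <= \sum_i Num.max (l i - t) 0 * sqabs (ip f (e i)).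
Proof.
case: spec => [[one eig _] le_a].
have hB := toeplitz_hform hilb frame Ls.
rewrite (hform_eigen_pythagoras one f hB eig).
rewrite (hform_eigen_pythagoras one (l := fun=> 1) f (rip_hform ip)); last first.
  by move=> i; exact: eigenvec_rip.
set r := f - proj ip e f.
have := le_a r (ip_residual one f).
have : a * rip ip r r <= t * rip ip r r by rewrite ler_wpM2r ?rip_ge0.
have : \sum_i l i * sqabs (ip f (e i)) - t * (\sum_i 1 * sqabs (ip f (e i))) <=
    \sum_i Num.max (l i - t) 0 * sqabs (ip f (e i)).
  rewrite mulr_sumr -sumrB; apply: ler_sum => i _.
  by rewrite mul1r -mulrBl ler_wpM2r ?sqabs_ge0 // le_max lexx.
lra.
Qed.

(** At [e' j] the form of [s'] is at most that of [s] plus that of [|s' - s|]. Summed over [j], the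
    first is handled by [form_le_excess] and Bessel for [e'] at each [e i], the second by the trace
    bound. *)
Lemma excess_compare (s' : T -> R) (J : finType) (e' : J -> H) (l' : J -> R) :
  L1 mu s' -> orthonormal_family ip e' ->
  (forall j, eigenvec ip (toeplitz_form ip mu k s') (e' j) (l' j)) ->
  excess l' <= excess l + Rint mu (fun x => `|s' x - s x|).
Proof.
move=> Ls' one' eig'.
have [[one _ _] _] := spec.
have Ld : L1 mu (fun x => `|s' x - s x|) by exact/L1_norm/L1B.
have h := toeplitz_trace_le hilb frame Ld (fun x => normr_ge0 _) one'.
apply: le_trans (lerD (lexx _) h).
have -> : excess l = \sum_i Num.max (l i - t) 0 * rip ip (e i) (e i).
  by apply: eq_bigr => i _; rewrite (rip_orthonormal one) mulr1.
have max0 i : 0 <= Num.max (l i - t) 0 by rewrite le_max lexx orbT.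
have /le_trans->// : excess l' <=
    \sum_j (\sum_i Num.max (l i - t) 0 * sqabs (ip (e' j) (e i)) +
      toeplitz_form ip mu k (fun x => `|s' x - s x|) (e' j) (e' j)).
  apply: ler_sum => j _; rewrite ge_max; apply/andP; split; last first.
    apply: addr_ge0; first by apply: sumr_ge0 => i _; rewrite mulr_ge0 ?sqabs_ge0.
    rewrite toeplitz_form_diag; apply: Rint_ge0 => x.
    by rewrite mulr_ge0 ?sqabs_ge0.
  have := form_le_excess (e' j).
  have := eig' j (e' j); rewrite (rip_orthonormal one' j) !mulr1 => <-.
  have : toeplitz_form ip mu k s' (e' j) (e' j) <= B (e' j) (e' j) +
      toeplitz_form ip mu k (fun x => `|s' x - s x|) (e' j) (e' j).
    rewrite !toeplitz_form_diag -RintD; [|exact: L1_sqabs..].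
    apply: le_Rint => [||x].
    - exact: L1_sqabs.
    - by apply: L1D; exact: L1_sqabs.
    rewrite -mulrDl ler_wpM2r ?sqabs_ge0 //.
    by have := ler_norm (s' x - s x); lra.
  by lra.
rewrite big_split lerD2r exchange_big ler_sum // => i _.
rewrite -mulr_sumr ler_wpM2l //; apply: le_trans (bessel one' (e i)).
by apply: ler_sum => j _; rewrite ipC sqabs_conj.
Qed.

(** The positive part of [B - t], evaluated at [k x]; by Parseval its integral is the trace
    [excess l]. *)
Definition excess_density x : R :=
  \sum_i Num.max (l i - t) 0 * sqabs (ip (k x) (e i)).

Lemma excess_density_ge x : B (k x) (k x) - t <= excess_density x.
Proof.
by have := form_le_excess (k x); rewrite (frame_rip hilb frame) mulr1.
Qed.

Lemma excess_density_ge0 x : 0 <= excess_density x.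
Proof.
by apply: sumr_ge0 => i _; rewrite mulr_ge0 ?sqabs_ge0 // le_max lexx orbT.
Qed.

Lemma excess_density_int :
  L1 mu excess_density /\ Rint mu excess_density = excess l.
Proof.
have [[one _ _] _] := spec.
have E x : excess_density x =
    \sum_i Num.max (l i - t) 0 * sqabs (ip (e i) (k x)).
  by apply: eq_bigr => i _; rewrite ipC sqabs_conj.
have Li i : L1 mu (fun x => Num.max (l i - t) 0 * sqabs (ip (e i) (k x))).
  by apply: L1Z; exact: (parseval_sqabs frame (e i)).1.
split; first by apply: eq_L1 (L1_sum Li) => x; rewrite E.
rewrite (eq_Rint mu E) (Rint_sum Li); apply: eq_bigr => i _.
have [Lw Ew] := parseval_sqabs frame (e i).
by rewrite RintZ // Ew (rip_orthonormal one) mulr1.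
Qed.

End TraceEstimates.

(** * Approximation by semicontinuous functions *)

Section SemicontinuousApproximation.
Context (R : realType) (X : ptopologicalType) (hausX : hausdorff_space X)
  (nu : {measure set (borel X) -> \bar R}) (radon_nu : radon nu).
Implicit Types (A U K : set (borel X)) (f g : borel X -> R).
Local Notation L1 := (L1 nu).
Local Notation Rint := (Rint nu).

Lemma borel_open (U : set X) : open U -> measurable (U : set (borel X)).
Proof. by move=> oU; exact: sub_sigma_algebra. Qed.

Lemma borel_compact (K : set X) : compact K -> measurable (K : set (borel X)).
Proof.
move=> /(compact_closed hausX)/closed_openC oK.
by rewrite -[K]setCK; apply: measurableC; exact: borel_open.
Qed.

Lemma L1_indicP A : measurable A -> L1 \1_A <-> (nu A < +oo)%E.
Proof.
move=> mA; have intA : (\int[nu]_x (\1_A x)%:E)%E = nu A.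
  by rewrite integral_indic // setIT.
split=> [LA|finA]; first by rewrite -intA; exact: integrable_lty.
apply/integrableP; split; first by apply/measurable_EFinP; exact: measurable_indic.
rewrite (eq_integral (fun x => (\1_A x)%:E)) ?intA // => x _ /=.
by rewrite ger0_norm.
Qed.

Lemma Rint_indic A : measurable A -> Rint \1_A = fine (nu A).
Proof. by move=> mA; rewrite /Rint /Rintegral integral_indic // setIT. Qed.

Lemma Rint_indicB A B : measurable A -> measurable B -> (nu B < +oo)%E ->
  A `<=` B -> Rint (fun x => `|\1_A x - \1_B x|) = fine (nu B) - fine (nu A).
Proof.
move=> mA mB finB AB.
have finA : (nu A < +oo)%E.
  by apply: le_lt_trans finB; apply: le_measure => //; rewrite inE.
rewrite -!Rint_indic // -RintB; try exact/L1_indicP.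
apply: eq_Rint => x; rewrite distrC ger0_norm // subr_ge0 !indicE ler_nat.
by case: (boolP (x \in A)) => // /set_mem/AB/mem_set ->.
Qed.

Definition lsc_bounded f : Prop :=
  [/\ L1 f, exists M, forall x, `|f x| <= M
    & forall x eps, 0 < eps -> nbhs (x : X) [set y : X | f x - eps <= f y]].

(** Lower semicontinuity survives sums and nonnegative multiples but not negation, so indicators are
    approximated below with either sign. *)
Definition lsc_approx f : Prop := L1 f /\ forall eps, 0 < eps ->
  exists g, lsc_bounded g /\ Rint (fun x => `|f x - g x|) <= eps.

Lemma lsc_boundedD f g : lsc_bounded f -> lsc_bounded g ->
  lsc_bounded (fun x => f x + g x).
Proof.
move=> [Lf [M fM] lf] [Lg [N gN] lg]; split; first exact: L1D.
  exists (M + N) => x; exact: le_trans (ler_normD _ _) (lerD (fM x) (gN x)).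
move=> x eps e0; have e20 : 0 < eps / 2 by rewrite divr_gt0.
apply: filterS2 (lf x _ e20) (lg x _ e20) => y /=; lra.
Qed.

Lemma lsc_boundedZ c f : 0 <= c -> lsc_bounded f ->
  lsc_bounded (fun x => c * f x).
Proof.
move=> c0 [Lf [M fM] lf]; split; first exact: L1Z.
  by exists (c * M) => x; rewrite normrM ger0_norm // ler_wpM2l.
move=> x eps e0.
(* [c] may be 0, so [eps] is divided by [c + 1]. *)
have c10 : 0 < c + 1 by lra.
apply: filterS (lf x _ (divr_gt0 e0 c10)) => y /= fxy.
have := ler_wpM2l c0 fxy.
have : c * (eps / (c + 1)) <= eps.
  by rewrite mulrA ler_pdivrMr // mulrC ler_wpM2l ?ltW //; lra.
lra.
Qed.

Lemma lsc_bounded_open U : open (U : set X) -> (nu U < +oo)%E ->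
  lsc_bounded \1_U.
Proof.
move=> oU finU; split; first by apply/L1_indicP => //; exact: borel_open.
  by exists 1 => x; rewrite indicE ger0_norm ?ler0n // lern1 leq_b1.
move=> x eps e0; have [xU|xU] := pselect (U x).
  apply: filterS (open_nbhs_nbhs (conj oU xU)) => y Uy /=.
  by rewrite !indicE !mem_set //=; lra.
apply: filterS filterT => y _ /=; rewrite indicE memNset //=.
by rewrite sub0r (le_trans (y := 0)) // oppr_le0 ltW.
Qed.

Lemma lsc_bounded_compact K : compact (K : set X) ->
  lsc_bounded (fun x => - \1_K x).
Proof.
move=> cK; have mK := borel_compact cK.
split.
- have LK : L1 \1_K by apply/L1_indicP => //; case: radon_nu => + _ _; apply.
  by apply: eq_L1 (L1Z (-1) LK) => x; rewrite mulN1r.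
- by exists 1 => x; rewrite normrN indicE ger0_norm ?ler0n // lern1 leq_b1.
move=> x eps e0; have [xK|xK] := pselect (K x).
  apply: filterS filterT => y _ /=; rewrite !indicE (mem_set xK).
  have : (y \in K)%:R <= 1 :> R by rewrite lern1 leq_b1.
  by rewrite mulr1n; lra.
have oK : open (~` K : set X) by apply: closed_openC; exact: compact_closed.
apply: filterS (open_nbhs_nbhs (conj oK xK)) => y Ky /=.
by rewrite !indicE !memNset //=; lra.
Qed.

Lemma lsc_bounded_0 : lsc_bounded (fun=> 0).
Proof.
split; first by have := @integrable0 _ _ _ nu setT.
  by exists 0 => x; rewrite normr0.
by move=> x eps e0; apply: filterS filterT => y _ /=; lra.
Qed.

Lemma lsc_approx_0 : lsc_approx (fun=> 0).
Proof.
have [L0 _ _] := lsc_bounded_0.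
split=> // eps e0; exists (fun=> 0); split; first exact: lsc_bounded_0.
rewrite (eq_Rint _ (g := fun=> 0 * 0)).
  by rewrite RintZ // mul0r ltW.
by move=> x; rewrite subrr normr0 mulr0.
Qed.

Lemma lsc_approxD f g : lsc_approx f -> lsc_approx g ->
  lsc_approx (fun x => f x + g x).
Proof.
move=> [Lf af] [Lg ag]; split=> [|eps e0]; first exact: L1D.
have e20 : 0 < eps / 2 by rewrite divr_gt0.
have [f' [lf' ff']] := af _ e20; have [g' [lg' gg']] := ag _ e20.
exists (fun x => f' x + g' x); split; first exact: lsc_boundedD.
have [Lf' _ _] := lf'; have [Lg' _ _] := lg'.
apply: le_trans (_ : _ <= eps / 2 + eps / 2) _; last by lra.
apply: le_trans (lerD ff' gg').
rewrite -RintD; try exact/L1_norm/L1B.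
apply: le_Rint => [||x]; first by apply/L1_norm/L1B; exact: L1D.
  by apply: L1D; exact/L1_norm/L1B.
by rewrite opprD addrACA ler_normD.
Qed.

Lemma lsc_approxZ c f : 0 <= c -> lsc_approx f -> lsc_approx (fun x => c * f x).
Proof.
move=> c0 [Lf af]; split=> [|eps e0]; first exact: L1Z.
have c10 : 0 < c + 1 by lra.
have [f' [lf' ff']] := af _ (divr_gt0 e0 c10).
have [Lf' _ _] := lf'.
exists (fun x => c * f' x); split; first exact: lsc_boundedZ.
rewrite (eq_Rint _ (g := fun x => c * `|f x - f' x|)); last first.
  by move=> x; rewrite -mulrBr normrM (ger0_norm c0).
rewrite RintZ; last exact/L1_norm/L1B.
apply: le_trans (ler_wpM2l c0 ff') _.
by rewrite mulrA ler_pdivrMr // mulrC ler_wpM2l ?ltW //; lra.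
Qed.

Lemma lsc_approx_sum (I : Type) (r : seq I) (F : I -> borel X -> R) :
  (forall i, lsc_approx (F i)) -> lsc_approx (fun x => \sum_(i <- r) F i x).
Proof.
move=> aF; elim: r => [|i r IH].
  rewrite (_ : (fun _ => _) = fun=> 0); first exact: lsc_approx_0.
  by apply/funext => x; rewrite big_nil.
rewrite (_ : (fun _ => _) = fun x => F i x + \sum_(j <- r) F j x).
  exact: lsc_approxD.
by apply/funext => x; rewrite big_cons.
Qed.

Lemma outer_open A eps : measurable A -> (nu A < +oo)%E -> 0 < eps ->
  exists U : set (borel X), [/\ open (U : set X), A `<=` U, (nu U < +oo)%E
    & fine (nu U) - fine (nu A) <= eps].
Proof.
move=> mA finA e0; case: radon_nu => _ /(_ A mA) nuA _.
have fA : nu A \is a fin_num by rewrite ge0_fin_numE.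
rewrite nuA in fA.
have [_ [U [oU AU] <-] ltU] := lb_ereal_inf_adherent e0 fA.
rewrite -nuA in fA ltU.
have finU : (nu U < +oo)%E by apply: lt_trans ltU _; rewrite -(fineK fA) -EFinD ltry.
exists U; split => //.
have fU : nu U \is a fin_num by rewrite ge0_fin_numE.
move: ltU; rewrite -(fineK fA) -(fineK fU) -EFinD lte_fin; lra.
Qed.

Lemma inner_compact U eps : open (U : set X) -> (nu U < +oo)%E -> 0 < eps ->
  exists K : set (borel X), [/\ compact (K : set X), K `<=` U
    & fine (nu U) - fine (nu K) <= eps].
Proof.
move=> oU finU e0; case: radon_nu => cptfin _ /(_ U oU) nuU.
have fU : nu U \is a fin_num by rewrite ge0_fin_numE.
rewrite nuU in fU.
have [_ [K [cK KU] <-] ltK] := ub_ereal_sup_adherent e0 fU.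
rewrite -nuU in fU ltK.
exists K; split => //.
have fK : nu K \is a fin_num by rewrite ge0_fin_numE // cptfin.
move: ltK; rewrite -(fineK fU) -(fineK fK) -EFinB lte_fin; lra.
Qed.

Lemma lsc_approx_indic A : measurable A -> L1 \1_A -> lsc_approx \1_A.
Proof.
move=> mA LA; split=> // eps e0.
have finA : (nu A < +oo)%E by apply/L1_indicP.
have [U [oU AU finU UA]] := outer_open mA finA e0.
exists \1_U; split; first exact: lsc_bounded_open.
by rewrite Rint_indicB //; exact: borel_open.
Qed.

(* With an open V and a compact L such that A <= V and L <= V, the function
   -1_A = 1_(V \ A) - 1_V is close to 1_W - 1_L for an open W around V \ A. *)
Lemma lsc_approx_indicN A : measurable A -> L1 \1_A ->
  lsc_approx (fun x => - \1_A x).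
Proof.
move=> mA LA; split=> [|eps e0].
  by apply: eq_L1 (L1Z (-1) LA) => x; rewrite mulN1r.
have e20 : 0 < eps / 2 by rewrite divr_gt0.
have finA : (nu A < +oo)%E by apply/L1_indicP.
have [V [oV AV finV VA]] := outer_open mA finA e20.
have mV := borel_open oV.
have [L [cL KV VK]] := inner_compact oV finV e20.
have mL := borel_compact cL.
have mD : measurable (V `\` A) by exact: measurableD.
have finD : (nu (V `\` A) < +oo)%E.
  by apply: le_lt_trans finV; apply: le_measure; rewrite ?inE.
have [W [oW DW finW WD]] := outer_open mD finD e20.
have mW := borel_open oW.
exists (fun x => \1_W x - \1_L x); split.
  by apply: lsc_boundedD; [exact: lsc_bounded_open|exact: lsc_bounded_compact].
have LW : L1 \1_W by apply/L1_indicP.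
have LV : L1 \1_V by apply/L1_indicP.
have LL : L1 \1_L.
  by apply/L1_indicP => //; apply: le_lt_trans finV; apply: le_measure; rewrite ?inE.
have LD : L1 \1_(V `\` A) by apply/L1_indicP.
have LDW : L1 (fun x => `|\1_(V `\` A) x - \1_W x|) by exact/L1_norm/L1B.
have LLV : L1 (fun x => `|\1_L x - \1_V x|) by exact/L1_norm/L1B.
have : Rint (fun x => `|- \1_A x - (\1_W x - \1_L x)|) <=
    Rint (fun x => `|\1_(V `\` A) x - \1_W x|) + Rint (fun x => `|\1_L x - \1_V x|).
  rewrite -RintD //; apply: le_Rint => [||x].
  - apply/L1_norm/L1B; last exact: L1B.
    by apply: eq_L1 (L1Z (-1) LA) => x; rewrite mulN1r.
  - exact: L1D.
  apply: le_trans (ler_normD _ _); rewrite le_eqVlt; apply/orP; left.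
  apply/eqP; congr `|_|.
  have -> : \1_(V `\` A) x = \1_V x - \1_A x :> R.
    rewrite !indicE in_setD.
    case: (boolP (x \in A)) => [/set_mem/AV/mem_set ->|_] /=.
      by rewrite subrr.
    by rewrite andbT subr0.
  ring.
rewrite !Rint_indicB //; lra.
Qed.

Lemma lsc_approx_indicZ c A : measurable A -> L1 \1_A ->
  lsc_approx (fun x => c * \1_A x).
Proof.
move=> mA LA; have [c0|c0] := leP 0 c.
  by apply: lsc_approxZ => //; exact: lsc_approx_indic.
rewrite (_ : (fun _ => _) = fun x => (- c) * (- \1_A x)).
  by apply: lsc_approxZ (lsc_approx_indicN mA LA); rewrite oppr_ge0 ltW.
by apply/funext => x; rewrite mulrNN.
Qed.

Lemma lsc_approx_sfun (g : {sfun borel X >-> R}) :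
  L1 (fun x => g x) -> lsc_approx (fun x => g x).
Proof.
move=> Lg.
rewrite (funext (fimfunEord g)).
apply: lsc_approx_sum => i; set c := _`_i.
have mA : measurable (g @^-1` [set c]) by exact: measurable_sfunP.
(* The level set of 0 may have infinite measure, so its zero term is treated apart; for other values
   the indicator is dominated by [|c|^-1 * |g|]. *)
have [->|c0] := eqVneq c 0.
  rewrite (_ : (fun _ => _) = fun=> 0); first exact: lsc_approx_0.
  by apply/funext => x; rewrite mul0r.
apply: lsc_approx_indicZ => //.
apply: L1_le (L1Z `|c|^-1 (L1_norm Lg)).
  exact: measurable_indic.
move=> x; rewrite indicE ger0_norm ?ler0n //.
case: (boolP (x \in _)) => [/set_mem /= ->|_].
  by rewrite mulVf ?normr_eq0.
by rewrite mulr_ge0 ?invr_ge0.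
Qed.

Theorem L1_lsc_approx f : L1 f -> lsc_approx f.
Proof.
move=> Lf; split=> // eps e0.
have e20 : 0 < eps / 2 by rewrite divr_gt0.
have [g [Lg _ /fine_cvgP[fing cvg0]]] :=
  approximation_sfun_integrable measurableT Lf.
move/cvgr0Pnorm_lt : cvg0 => /(_ _ e20) near0.
have [n gn] := filter_ex near0.
have [_ /(_ _ e20)[h [lh gh]]] := lsc_approx_sfun (Lg n).
exists h; split=> //.
have [Lh _ _] := lh.
have : Rint (fun x => `|f x - h x|) <=
    Rint (fun x => `|f x - g n x|) + Rint (fun x => `|g n x - h x|).
  rewrite -RintD; try by apply/L1_norm/L1B => //; exact: Lg.
  apply: le_Rint => [||x]; first exact/L1_norm/L1B.
    by apply: L1D; apply/L1_norm/L1B => //; exact: Lg.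
  by rewrite -[X in `|X|](subrKA (g n x)) ler_normD.
have : Rint (fun x => `|f x - g n x|) < eps / 2.
  by apply: le_lt_trans gn; rewrite /= ler_norm.
lra.
Qed.

End SemicontinuousApproximation.

(** * Asymptotics *)

Section ScaledMeasure.
Context d (T : measurableType d) (R : realType)
  (mu nu : {measure set T -> \bar R}) (c : R) (c_gt0 : 0 < c)
  (muE : forall B, measurable B -> mu B = (c%:E * nu B)%E).

Lemma ge0_integral_scaled (f : T -> R) : measurable_fun [set: T] f ->
  (forall x, 0 <= f x) ->
  (\int[mu]_x (f x)%:E = c%:E * \int[nu]_x (f x)%:E)%E.
Proof.
move=> mf f0; pose c' : {nonneg R} := NngNum (ltW c_gt0).
rewrite (eq_measure_integral (mscale c' nu)); last by move=> B mB _; exact: muE.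
rewrite ge0_integral_mscale //; first exact/measurable_EFinP.
by move=> x _; rewrite lee_fin.
Qed.

Lemma L1_scaled (f : T -> R) : L1 mu f <-> L1 nu f.
Proof.
have E : measurable_fun [set: T] f ->
    (\int[mu]_x `|(f x)%:E| = c%:E * \int[nu]_x `|(f x)%:E|)%E.
  by move=> mf; rewrite -ge0_integral_scaled //; exact: measurableT_comp.
split=> /integrableP[mf finf]; apply/integrableP; split => //.
  move: finf; rewrite E; last exact/measurable_EFinP.
  by rewrite -[X in (_ < X)%E](gt0_muley (x := c%:E)) ?lte_fin // lte_pmul2l.
rewrite E; last exact/measurable_EFinP.
by rewrite -[X in (_ < X)%E](gt0_muley (x := c%:E)) ?lte_fin // lte_pmul2l.
Qed.

Lemma Rint_scaled (f : T -> R) : L1 nu f -> (forall x, 0 <= f x) ->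
  Rint mu f = c * Rint nu f.
Proof.
move=> Lf f0; apply: EFin_inj; rewrite EFinM -!Rint_EFin //; last exact/L1_scaled.
by rewrite ge0_integral_scaled //; exact: L1_measurable Lf.
Qed.

End ScaledMeasure.

(** Capped at [g], the functions [h n] converge to [g] and are dominated by [g], so dominated
    convergence applies. *)
Lemma fatou_bound d (T : measurableType d) (R : realType)
    (mu : {measure set T -> \bar R}) (h : nat -> T -> R) (g : T -> R) (B : R) :
  L1 mu g -> (forall x, 0 <= g x) ->
  (forall n, L1 mu (h n)) -> (forall n x, 0 <= h n x) ->
  (forall x eps, 0 < eps -> \forall n \near \oo, g x - eps <= h n x) ->
  (forall n, Rint mu (h n) <= B) -> Rint mu g <= B.
Proof.
move=> Lg g0 Lh h0 gh hB.
pose m n x := Num.min (h n x) (g x).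
have mm n : measurable_fun [set: T] (m n).
  by apply: measurable_minr; [exact: L1_measurable (Lh n)|exact: L1_measurable Lg].
have mg n x : `|m n x| <= g x.
  by rewrite ger0_norm ?le_min ?h0 ?g0 // ge_min lexx orbT.
have Lm n : L1 mu (m n) by exact: L1_le (mm n) (mg n) Lg.
have cv : (\int[mu]_x (m n x)%:E)%E @[n --> \oo] --> (\int[mu]_x (g x)%:E)%E.
  apply: (@dominated_cvg _ _ _ mu setT measurableT (fun n => EFin \o m n)
    (EFin \o g) (EFin \o g)) => //.
  - by move=> n; exact/measurable_EFinP.
  - move=> x _; apply: cvg_EFin; first by apply: nearW.
    apply/cvgrPdist_le => eps e0; near=> n.
    have gxh : g x - eps <= h n x by near: n; exact: gh.
    rewrite /= ger0_norm; last by rewrite subr_ge0 ge_min lexx orbT.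
    by rewrite lerBlDl -lerBlDr le_min gxh; lra.
  - by move=> n x _; rewrite /= lee_fin.
rewrite -lee_fin -Rint_EFin //; apply: (cvge_to_le cv).
apply: nearW => n; rewrite [leLHS](_ : _ = (Rint mu (m n))%:E).
  by rewrite lee_fin; apply: le_trans (hB n); apply: le_Rint => // x;
    rewrite ge_min lexx.
exact: Rint_EFin.
Unshelve. all: by end_near. Qed.

(** * Lower bound for the excess by localization *)

Section Asymptotics.
Context (R : realType) (X : ptopologicalType) (hausX : hausdorff_space X).
Context (A : set R) (H : R -> completeNormedModType R[i])
  (ip : forall alpha : R, {dot (H alpha) for (@conjC R[i])})
  (hilbH : forall alpha : R, A alpha -> norm_from_dot (ip alpha))
  (k : forall alpha : R, X -> H alpha)
  (nu_ : R -> {measure set (borel X) -> \bar R})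
  (frame : forall alpha : R, A alpha ->
     normalized_parseval_frame (ip alpha) (nu_ alpha) (k alpha))
  (nu : {measure set (borel X) -> \bar R}) (radon_nu : radon nu)
  (c : R -> R) (c_gt0 : forall alpha : R, A alpha -> 0 < c alpha)
  (nu_E : forall alpha : R, A alpha -> forall B : set (borel X), measurable B ->
     nu_ alpha B = ((c alpha)%:E * nu B)%E)
  (localized : forall (x : X) (U : set (borel X)), nbhs (x : X) (U : set X) ->
     measurable U ->
     (\int[nu_ alpha]_(y in ~` U)
        ((Normc.normc (ip alpha (k alpha x) (k alpha y)) ^+ 2)%:E))%E
       @[alpha --> within A +oo] --> 0%E).
Implicit Types (s tau : borel X -> R).

Local Notation form alpha s :=
  (toeplitz_form (ip alpha) (nu_ alpha) (k alpha) s).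

(** The right-hand side averages [tau] against weights of total mass 1. On a neighborhood [V] of [x]
    semicontinuity bounds [tau] from below; the mass outside [V] tends to 0 and [tau] is bounded. *)
Lemma berezin_lower tau x eps : lsc_bounded nu tau -> 0 < eps ->
  \forall alpha \near within A +oo,
    tau x - eps <= (form alpha tau) (k alpha x) (k alpha x).
Proof.
move=> [Ltau [M tauM] lsc] e0; have e20 : 0 < eps / 2 by rewrite divr_gt0.
have M0 : 0 <= M by apply: le_trans (tauM point).
have /= := lsc x _ e20; rewrite nbhsE => -[V [oV Vx] Vtau].
have mV := borel_open oV.
(* Outside [V] the value drops by at most [2 * M]; the added 1 makes the divisor positive. *)
pose M2 := 2 * M + 1.
have M20 : 0 < M2 by rewrite /M2; lra.
have /fine_cvgP[_ /cvgr0Pnorm_lt /(_ _ (divr_gt0 e20 M20))] :=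
  localized (open_nbhs_nbhs (conj oV Vx)) mV.
have inA : \forall alpha \near within A +oo, A alpha by apply: withinT.
apply: filterS2 inA => alpha Aalpha /=.
set f := k alpha x.
have [Lw Ew] := parseval_sqabs (frame Aalpha) f.
have fE : rip (ip alpha) f f = 1 by exact: (frame_rip (hilbH Aalpha) (frame Aalpha)).
pose w y := sqabs (ip alpha f (k alpha y)).
pose w' y := \1_(~` V) y * w y.
have mw' : measurable_fun [set: borel X] w'.
  apply: measurable_funM; last exact: L1_measurable Lw.
  by apply: measurable_indic; exact: measurableC.
have Lw' : L1 (nu_ alpha) w'.
  apply: L1_le mw' _ Lw => y; rewrite /w' normrM (ger0_norm (sqabs_ge0 _)).
  by rewrite ler_piMl ?sqabs_ge0 // indicE ger0_norm ?ler0n // lern1 leq_b1.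
rewrite (_ : fine _ = Rint (nu_ alpha) w'); last first.
  rewrite /Rint /Rintegral [in LHS]/= [in LHS]integral_mkcond; congr fine.
  apply: eq_integral => y _; rewrite patchE /w' indicE.
  by case: ifP => _; rewrite ?mul0r ?mul1r // sqabsE.
rewrite ltr_pdivlMr // => /ltW w'small.
have Lt : L1 (nu_ alpha) tau by exact/(L1_scaled (c_gt0 Aalpha) (nu_E Aalpha)).
rewrite toeplitz_form_diag.
have w0 y : 0 <= w y by exact: sqabs_ge0.
have le_int : Rint (nu_ alpha) (fun y => (tau x - eps / 2) * w y - M2 * w' y) <=
    Rint (nu_ alpha) (fun y => tau y * w y).
  apply: le_Rint => [||y].
  - by apply: L1B; exact: L1Z.
  - exact: (L1_sqabs (hilbH Aalpha) (frame Aalpha)).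
  rewrite /w' mulrA -mulrBl ler_wpM2r // indicE.
  have [yV|yV] := pselect (V y).
    by rewrite memNset /= ?mulr0 ?subr0; [exact: Vtau|move=> /(_ yV)].
  rewrite mem_set //= mulr1 /M2.
  have := tauM x; have := tauM y; rewrite !ler_norml => /andP[? _] /andP[_ ?].
  by move: e0; lra.
apply: le_trans le_int.
rewrite RintB ?RintZ //; try exact: L1Z.
rewrite Ew fE mulr1.
have : M2 * Rint (nu_ alpha) w' <= eps / 2.
  by apply: le_trans w'small; rewrite mulrC (ler_wpM2r (ltW M20)) // ler_norm.
lra.
Qed.

(** Fatou's lemma concerns sequences, so failure is turned into parameters [alpha > n], one for each
    [n], whose excess densities violate the bound. *)
Lemma excess_lower_lsc tau t eps : lsc_bounded nu tau -> 0 < t -> 0 < eps ->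
  \forall alpha \near within A +oo,
  forall (I : finType) (e : I -> H alpha) (l : I -> R),
    spectral_family (ip alpha) (form alpha tau) t e l ->
    c alpha * (Rint nu (fun x => Num.max (tau x - t) 0) - eps) <= excess t l.
Proof.
move=> ltau t0 e0; have [Ltau _ _] := ltau.
apply: contrapT => not_near.
pose g x := Num.max (tau x - t) 0.
have Lg : L1 nu g by exact/L1_pos_part/ltW.
(* Only the density is kept, as a function on [X], so that the choice of a sequence does not involve
   the varying spaces [H alpha]. *)
pose bad alpha (h : borel X -> R) := [/\ A alpha, L1 nu h,
  forall x, 0 <= h x, forall x, (form alpha tau) (k alpha x) (k alpha x) - t <= h x
  & Rint nu h <= Rint nu g - eps].
have ex n : exists ah : R * (borel X -> R), n%:R < ah.1 /\ bad ah.1 ah.2.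
  apply: contrapT => none; apply: not_near.
  exists n%:R; split; first exact: num_real.
  move=> alpha n_alpha Aalpha I e l spec; rewrite leNgt; apply/negP => lt_exc.
  have Lt : L1 (nu_ alpha) tau by exact/(L1_scaled (c_gt0 Aalpha) (nu_E Aalpha)).
  have [Lh Eh] := excess_density_int (frame Aalpha) spec t.
  have Lh' := (L1_scaled (c_gt0 Aalpha) (nu_E Aalpha) _).1 Lh.
  apply: none.
  exists (alpha, excess_density (T := borel X) (ip alpha) (k alpha) e l t).
  split=> //; split=> //.
  - by move=> x; exact: excess_density_ge0.
  - by move=> x; exact: (excess_density_ge (hilbH Aalpha) (frame Aalpha)
      Lt spec (lexx t)).
  move: lt_exc; rewrite -Eh.
  rewrite (Rint_scaled (c_gt0 Aalpha) (nu_E Aalpha)) //; last first.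
    by move=> y; exact: excess_density_ge0.
  by rewrite ltr_pM2l ?c_gt0 // => /ltW.
have [F FP] := choice ex.
have /(_ (Rint nu g - eps)) : forall B,
    (forall n, Rint nu (F n).2 <= B) -> Rint nu g <= B.
  move=> B; apply: fatou_bound => //.
  - by move=> x; rewrite le_max lexx orbT.
  - by move=> n; have [_ []] := FP n.
  - by move=> n; have [_ []] := FP n.
  move=> x eta eta0.
  have [M [_ MP]] := berezin_lower x ltau eta0.
  exists (Num.bound `|M|) => // n /= Mn.
  have [n_lt [An _ hn0 hn _]] := FP n.
  have : M < (F n).1.
    apply: le_lt_trans (ler_norm M) _; apply: lt_trans n_lt.
    by apply: lt_le_trans (archi_boundP (normr_ge0 M)) _; rewrite ler_nat.
  move=> /MP/(_ An) h1; rewrite /g lerBlDr ge_max; apply/andP; split.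
    by have := hn x; lra.
  by have := hn0 x; lra.
have H' n : Rint nu (F n).2 <= Rint nu g - eps by have [_ []] := FP n.
by move/(_ H'); lra.
Qed.

(** Passing to a semicontinuous [tau] costs [eps / 3] in the integral, [eps / 3] in the excess by
    [excess_compare], and [eps / 3] in the bound for [tau]. *)
Lemma excess_lower s t eps : L1 nu s -> 0 < t -> 0 < eps ->
  \forall alpha \near within A +oo, forall a (I : finType) (e : I -> H alpha)
    (l : I -> R), a <= t -> spectral_family (ip alpha) (form alpha s) a e l ->
    c alpha * (Rint nu (fun x => Num.max (s x - t) 0) - eps) <= excess t l.
Proof.
move=> Ls t0 e0; have e30 : 0 < eps / 3 by rewrite divr_gt0.
have [_ /(_ _ e30)[tau [ltau stau]]] := L1_lsc_approx hausX radon_nu Ls.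
have [Ltau _ _] := ltau.
have inA : \forall alpha \near within A +oo, A alpha by apply: withinT.
apply: filterS2 inA (excess_lower_lsc ltau t0 e30) => alpha Aalpha low.
move=> a I e l at_ spec.
have scaled f := L1_scaled (c_gt0 Aalpha) (nu_E Aalpha) f.
have Ltau' : L1 (nu_ alpha) tau by exact/scaled.
have Ls' : L1 (nu_ alpha) s by exact/scaled.
have [J [e' [l' spec']]] :=
  toeplitz_spectral_family (hilbH Aalpha) (frame Aalpha) Ltau' t0.
have := low J e' l' spec'.
have [[one' eig' _] _] := spec'.
have := excess_compare (hilbH Aalpha) (frame Aalpha) Ls' spec at_ Ltau' one' eig'.
have Ld : L1 nu (fun x => `|tau x - s x|) by exact/L1_norm/L1B.
rewrite (Rint_scaled (c_gt0 Aalpha) (nu_E Aalpha)) //.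
have E : Rint nu (fun x => `|tau x - s x|) = Rint nu (fun x => `|s x - tau x|).
  by apply: eq_Rint => x; rewrite distrC.
have Lp := L1_pos_part Ls (ltW t0); have Lp' := L1_pos_part Ltau (ltW t0).
have : Rint nu (fun x => Num.max (s x - t) 0) <=
    Rint nu (fun x => Num.max (tau x - t) 0) + Rint nu (fun x => `|tau x - s x|).
  rewrite -RintD //; apply: le_Rint => [//||x]; first exact: L1D.
  have := ler_norm (s x - tau x); rewrite distrC.
  have := normr_ge0 (tau x - s x).
  have : Num.max (tau x - t) 0 >= tau x - t by rewrite le_max lexx.
  have : Num.max (tau x - t) 0 >= 0 by rewrite le_max lexx orbT.
  by rewrite ge_max => *; apply/andP; split; lra.
rewrite E; set p := Rint _ _; set q := Rint _ _; set r := Rint _ _.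
move=> pqr h1 h2.
have c0 := c_gt0 Aalpha.
have : c alpha * r <= c alpha * (eps / 3) by rewrite (ler_wpM2l (ltW c0)).
have : c alpha * p <= c alpha * (q + r) by rewrite (ler_wpM2l (ltW c0)).
have := mulr_gt0 c0 e0.
move: h1 h2; lra.
Qed.

End Asymptotics.

(** Termwise, (x - a)_+ - (x - b)_+ is [b - a] for [x > b], is 0 for [x <= a], and lies in between
    otherwise. *)
Lemma excess_diff (R : realType) (I : finType) (l : I -> R) (a b : R) : a < b ->
  (b - a) * #|[pred i | b < l i]|%:R <= excess a l - excess b l <=
  (b - a) * #|[pred i | a < l i]|%:R.
Proof.
move=> ab; have cardE (P : pred I) : #|P|%:R = \sum_i (P i)%:R :> R.
  by rewrite -natr_sum -sum1_card big_mkcond.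
rewrite !cardE !mulr_sumr /excess -sumrB; apply/andP.
have maxE (x : R) : Num.max x 0 = if 0 <= x then x else 0 by case: leP.
split; apply: ler_sum => i _; rewrite !maxE /= !subr_ge0.
  by case: (leP a (l i)); case: (leP b (l i)); case: (ltP b (l i)) => /=;
    rewrite ?mulr1n ?mulr0n; lra.
by case: (leP a (l i)); case: (leP b (l i)); case: (ltP a (l i)) => /=;
  rewrite ?mulr1n ?mulr0n; lra.
Qed.

(** * Measures of superlevel sets and their continuity in the level *)

Section LevelSets.
Context d (T : measurableType d) (R : realType)
  (nu : {measure set T -> \bar R}) (s : T -> R) (Ls : L1 nu s).
Local Notation E a := [set x | (a < s x)%R].

Lemma measurable_level a : measurable (E a).
Proof.
rewrite (_ : E a = [set: T] `&` s @^-1` `]a, +oo[%classic).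
  by apply: (L1_measurable Ls) => //; exact: measurable_itv.
by rewrite setTI; apply/seteqP; split=> x /=; rewrite in_itv /= andbT.
Qed.

Lemma L1_level a : 0 < a -> L1 nu \1_(E a).
Proof.
move=> a0; apply: (@L1_le _ _ _ nu _ (fun x => a^-1 * `|s x|)).
- by apply: measurable_indic; exact: measurable_level.
- move=> x; rewrite indicE ger0_norm ?ler0n //.
  case: (boolP (x \in _)) => [/set_mem /= ax|_]; last first.
    by rewrite mulr_ge0 // invr_ge0 ltW.
  rewrite mulr1n -[1](mulVf (lt0r_neq0 a0)) ler_wpM2l ?invr_ge0 ?(ltW a0) //.
  exact: le_trans (ltW ax) (ler_norm _).
- exact/L1Z/L1_norm.
Qed.

Lemma level_finite a : 0 < a -> (nu (E a) < +oo)%E.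
Proof.
move=> /L1_level LE.
rewrite -[E a]setIT -integral_indic //; last exact: measurable_level.
exact: integrable_lty LE.
Qed.

Lemma Rint_level a : Rint nu \1_(E a) = fine (nu (E a)).
Proof.
by rewrite /Rint /Rintegral integral_indic ?setIT //; exact: measurable_level.
Qed.

(** The pointwise inequality behind [excess_diff], integrated over the symbol instead of summed over
    eigenvalues. *)
Lemma pos_part_diff a b : 0 < a -> a < b ->
  (b - a) * fine (nu (E b)) <=
  Rint nu (fun x => Num.max (s x - a) 0) - Rint nu (fun x => Num.max (s x - b) 0)
  <= (b - a) * fine (nu (E a)).
Proof.
move=> a0 ab; have b0 := lt_trans a0 ab.
have maxE (y : R) : Num.max y 0 = if 0 <= y then y else 0 by case: leP.
have indicE_level u x : \1_(E u) x = (u < s x)%R%:R :> R.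
  by rewrite indicE; congr (nat_of_bool _)%:R; apply/idP/idP; rewrite inE.
have La := L1_pos_part Ls (ltW a0); have Lb := L1_pos_part Ls (ltW b0).
rewrite -!Rint_level -RintB // -!RintZ; try exact: L1_level.
apply/andP; split; apply: le_Rint => [||x]; try exact: L1B;
  try by apply: L1Z; exact: L1_level.
  rewrite !maxE (indicE_level b) !subr_ge0.
  by case: (leP a (s x)); case: (leP b (s x)); case: (ltP b (s x)) => /=;
    rewrite ?mulr1n ?mulr0n; lra.
rewrite !maxE (indicE_level a) !subr_ge0.
by case: (leP a (s x)); case: (leP b (s x)); case: (ltP a (s x)) => /=;
  rewrite ?mulr1n ?mulr0n; lra.
Qed.

(** Continuity from below along levels decreasing to [t]. *)
Lemma level_inner t eps : 0 < t -> 0 < eps ->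
  exists2 b, t < b & fine (nu (E t)) - eps <= fine (nu (E b)).
Proof.
move=> t0 e0; pose F n := E (t + n.+1%:R^-1).
have FE : \bigcup_n F n = E t.
  apply/seteqP; split=> x /= => [[n _]|tx]; rewrite /F /=.
    by apply: le_lt_trans; rewrite lerDl.
  have [n] := ltr_add_invr tx.
  by exists n.
have cv : nu \o F @ \oo --> nu (E t).
  rewrite -FE; apply: nondecreasing_cvg_mu.
  - by move=> i; exact: measurable_level.
  - by rewrite FE; exact: measurable_level.
  - move=> m n mn; apply/subsetPset => x /=; apply: le_lt_trans.
    by rewrite lerD2l lef_pV2 ?posrE ?ltr0n // ler_nat ltnS.
have fin : nu (E t) \is a fin_num by rewrite ge0_fin_numE // level_finite.
move: cv; rewrite -(fineK fin) => /fine_cvgP[_ /cvgrPdist_le /(_ _ e0)[n _ nP]].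
exists (t + n.+1%:R^-1); first by rewrite ltrDl invr_gt0 ltr0n.
by have := nP n (leqnn n); rewrite /= ler_distlC => /andP[].
Qed.

(** Continuity from above along levels increasing to [t]; the intersection is {s >= t}, which
    differs from {s > t} by a null set. *)
Lemma level_outer t eps : 0 < t -> 0 < eps -> nu [set x | s x = t] = 0%E ->
  exists a, [/\ 0 < a, a < t & fine (nu (E a)) <= fine (nu (E t)) + eps].
Proof.
(* Starting at [n.+2] keeps every level positive, so that the sets have finite measure. *)
move=> t0 e0 null; pose F n := E (t - t / n.+2%:R).
have pos n : 0 < t - t / n.+2%:R.
  rewrite subr_gt0 ltr_pdivrMr ?ltr0n // ltr_pMr // ltr1n.
  by [].
have FE : \bigcap_n F n = [set x | (t <= s x)%R].
  apply/seteqP; split=> x /= => [tx|tx n _]; rewrite /F /=.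
    rewrite leNgt; apply/negP => xt.
    have d0 : 0 < (t - s x) / t by rewrite divr_gt0 // subr_gt0.
    have [n] := ltr_add_invr d0; rewrite add0r => nd.
    have := tx n I; rewrite /F /= ltrBlDr -ltrBlDl => ltn.
    have : n.+2%:R^-1 < (t - s x) / t.
      by apply: lt_trans nd; rewrite ltf_pV2 ?posrE ?ltr0n // ltr_nat.
    by rewrite ltr_pdivlMr // mulrC => /lt_trans/(_ ltn); rewrite ltxx.
  by apply: lt_le_trans tx; rewrite ltrBlDr ltrDl divr_gt0 ?ltr0n.
have mge : measurable [set x | (t <= s x)%R].
  by rewrite -FE; apply: bigcapT_measurable => n; exact: measurable_level.
have cv : nu \o F @ \oo --> nu [set x | (t <= s x)%R].
  rewrite -FE; apply: nonincreasing_cvg_mu.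
  - exact: level_finite.
  - by move=> i; exact: measurable_level.
  - by rewrite FE.
  - move=> m n mn; apply/subsetPset => x /=; apply: le_lt_trans.
    rewrite lerD2l lerN2 ler_wpM2l ?(ltW t0) //.
    by rewrite lef_pV2 ?posrE ?ltr0n // ler_nat !ltnS.
have meq : measurable [set x | s x = t].
  rewrite (_ : [set x | s x = t] = [set x | (t <= s x)%R] `\` E t).
    by apply: measurableD => //; exact: measurable_level.
  apply/seteqP; split=> x /= => [->|[tx /negP]]; first by rewrite ltxx lexx.
  by rewrite -leNgt => xt; apply/le_anti; rewrite xt tx.
have nuE : nu [set x | (t <= s x)%R] = nu (E t).
  rewrite (_ : [set x | (t <= s x)%R] = E t `|` [set x | s x = t]).
    by apply: measureU0 => //; exact: measurable_level.
  apply/seteqP; split=> x /= => [|[/ltW//|->//]].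
  by rewrite le_eqVlt => /orP[/eqP->|]; [right|left].
have fin : nu (E t) \is a fin_num by rewrite ge0_fin_numE // level_finite.
move: cv; rewrite nuE -(fineK fin) => /fine_cvgP[_ /cvgrPdist_le /(_ _ e0)[n _ nP]].
exists (t - t / n.+2%:R); split=> //.
  by rewrite ltrBlDr ltrDl divr_gt0 ?ltr0n.
by have := nP n (leqnn n); rewrite /= ler_distlC => /andP[].
Qed.

End LevelSets.

(** * The count squeezed between difference quotients of the excess *)

Theorem corollary5p5 (R : realType) (X : ptopologicalType)
    (hausX : hausdorff_space X) (lcptX : locally_compact [set: X])
    (* the parameter alpha ranges over an unbounded set of reals *)
    (A : set R) (unbA : forall M : R, exists2 alpha, A alpha & M < alpha)
    (H : R -> completeNormedModType R[i])
    (ip : forall alpha : R, {dot (H alpha) for (@conjC R[i])})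
    (hilbH : forall alpha : R, A alpha -> norm_from_dot (ip alpha))
    (k : forall alpha : R, X -> H alpha)
    (nu_ : R -> {measure set (borel X) -> \bar R})
    (radon_nu_ : forall alpha : R, A alpha -> radon (nu_ alpha))
    (frame : forall alpha : R, A alpha ->
       normalized_parseval_frame (ip alpha) (nu_ alpha) (k alpha))
    (nu : {measure set (borel X) -> \bar R}) (radon_nu : radon nu)
    (c : R -> R) (c_gt0 : forall alpha : R, A alpha -> 0 < c alpha)
    (nu_E : forall alpha : R, A alpha -> forall B : set (borel X), measurable B ->
       nu_ alpha B = ((c alpha)%:E * nu B)%E)
    (localized : forall (x : X) (U : set (borel X)), nbhs (x : X) (U : set X) ->
       measurable U ->
       (\int[nu_ alpha]_(y in ~` U)
          ((Normc.normc (ip alpha (k alpha x) (k alpha y)) ^+ 2)%:E))%E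
         @[alpha --> within A +oo] --> 0%E)
    (sigma : borel X -> R)
    (sigma_L1 : nu.-integrable [set: borel X] (fun x => (sigma x)%:E))
    (sigma_bnd_or_ge0 :
       (exists M : R, {ae nu, forall x, `|sigma x| <= M}) \/
       {ae nu, forall x, 0 <= sigma x})
    (t : R) (t_gt0 : 0 < t)
    (level_null : nu [set x | sigma x = t] = 0%E) :
  (((c alpha)^-1)%:E *
     eigenvalue_count (toeplitz (ip alpha) (nu_ alpha) (k alpha) sigma) t)%E
    @[alpha --> within A +oo] --> nu [set x | t < sigma x].
Proof.
have Ls : L1 nu sigma := sigma_L1.
have Ls_ alpha : A alpha -> L1 (nu_ alpha) sigma.
  move=> Aalpha; exact ((L1_scaled (c_gt0 _ Aalpha) (nu_E _ Aalpha) sigma).2 Ls).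
have fin_level : nu [set x | t < sigma x] \is a fin_num.
  by rewrite ge0_fin_numE //; exact: level_finite.
set v := nu _ in fin_level *.
have inA : \forall alpha \near within A +oo, A alpha by apply: withinT.
have spectral alpha a : A alpha -> 0 < a ->
    exists (I : finType) (e : I -> H alpha) (l : I -> R),
      spectral_family (ip alpha)
        (toeplitz_form (ip alpha) (nu_ alpha) (k alpha) sigma) a e l.
  move=> Aalpha a0.
  exact (toeplitz_spectral_family (hilbH _ Aalpha) (frame _ Aalpha)
    (Ls_ _ Aalpha) a0).
have count alpha a (I : finType) (e : I -> H alpha) (l : I -> R) :
    A alpha -> 0 < a -> a <= t -> spectral_family (ip alpha)
      (toeplitz_form (ip alpha) (nu_ alpha) (k alpha) sigma) a e l ->
    eigenvalue_count (toeplitz (ip alpha) (nu_ alpha) (k alpha) sigma) t =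
    (#|[pred i | t < l i]|%:R)%:E.
  move=> Aalpha a0 at_ spec.
  exact (eigenvalue_countE (hilbH _ Aalpha) (frame _ Aalpha)
    (Ls_ _ Aalpha) a0 spec at_).
rewrite -(fineK fin_level); apply: cvg_EFin.
  apply: filterS inA => alpha Aalpha.
  have [I [e [l spec]]] := spectral alpha t Aalpha t_gt0.
  by rewrite (count _ _ _ _ _ Aalpha t_gt0 (lexx t) spec).
apply/cvgrPdist_le => eps e0; have e20 : 0 < eps / 2 by rewrite divr_gt0.
have [b tb nu_b] := level_inner sigma_L1 t_gt0 e20.
have [a [a0 at_ nu_a]] := level_outer sigma_L1 t_gt0 e20 level_null.
rewrite -/v in nu_a nu_b.
(* After division by [t - a] or [b - t], the error [eta] is at most [eps / 2]. *)
pose eta := Num.min (t - a) (b - t) * (eps / 2).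
have eta0 : 0 < eta by rewrite mulr_gt0 // lt_min !subr_gt0 at_.
apply: filterS2 inA (excess_lower hausX hilbH frame radon_nu c_gt0 nu_E
  localized sigma_L1 t_gt0 eta0) => alpha Aalpha low.
(* A single family with the lowest threshold [a] serves the excesses at [a], [t] and [b]. *)
have [I [e [l spec]]] := spectral alpha a Aalpha a0.
rewrite /= (count _ _ _ _ _ Aalpha a0 (ltW at_) spec) /=.
pose F u := Rint nu (fun x => Num.max (sigma x - u) 0).
have upper u : 0 < u -> excess u l <= c alpha * F u.
  move=> u0; apply: le_trans
    (excess_le (hilbH _ Aalpha) (frame _ Aalpha) (Ls_ _ Aalpha) spec (ltW u0)) _.
  rewrite (Rint_scaled (c_gt0 _ Aalpha) (nu_E _ Aalpha)) //.
    exact: (L1_pos_part sigma_L1 (ltW u0)).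
  by move=> x; rewrite le_max lexx orbT.
have low_t := low a I e l (ltW at_) spec.
have up_a := upper a a0.
have up_b := upper b (lt_trans t_gt0 tb).
have /andP[cnt_a _] := excess_diff l at_.
have /andP[_ cnt_b] := excess_diff l tb.
have /andP[_ diff_a] := pos_part_diff sigma_L1 a0 at_.
have /andP[diff_b _] := pos_part_diff sigma_L1 t_gt0 tb.
rewrite -/(F a) -/(F t) -/(F b) in low_t diff_a diff_b.
move: cnt_a cnt_b; set N := #|_|%:R => cnt_a cnt_b.
have c0 := c_gt0 _ Aalpha; set C := c alpha in c0 low_t up_a up_b *.
have NC : C * (C^-1 * N) = N by rewrite mulrA mulfV ?mul1r // gt_eqF.
have eta_a : eta <= (t - a) * (eps / 2).
  by rewrite ler_wpM2r ?(ltW e20) // ge_min lexx.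
have eta_b : eta <= (b - t) * (eps / 2).
  by rewrite ler_wpM2r ?(ltW e20) // ge_min lexx orbT.
have ta0 : 0 < t - a by rewrite subr_gt0.
have bt0 : 0 < b - t by rewrite subr_gt0.
have step u (p q : R) : 0 < u -> u * p <= u * q -> p <= q.
  by move=> u0; rewrite ler_pM2l.
(* The excess is bounded above at [a] and below at [t]; half of [eps] pays for [eta], half for
   replacing the level [a] by [t]. The lower bound is symmetric, with [b] for [a]. *)
have upN : C^-1 * N <= fine v + eps.
  apply: (step ((t - a) * C)); first exact: mulr_gt0.
  rewrite -mulrA NC; apply: (le_trans cnt_a).
  have : C * (F a - F t + eta) <= C * ((t - a) * (fine v + eps)).
    apply: (ler_wpM2l (ltW c0)).
    have := ler_wpM2l (ltW ta0) nu_a; lra.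
  by rewrite mulrCA !mulrA; lra.
have lowN : fine v - eps <= C^-1 * N.
  apply: (step ((b - t) * C)); first exact: mulr_gt0.
  rewrite -[leRHS]mulrA NC; apply: le_trans cnt_b.
  have : C * ((b - t) * (fine v - eps)) <= C * (F t - eta - F b).
    apply: (ler_wpM2l (ltW c0)).
    have := ler_wpM2l (ltW bt0) nu_b; lra.
  by rewrite mulrCA !mulrA; lra.
by rewrite ler_distl; apply/andP; split; lra.
Qed.
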